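(* Let $0\le u,v,w\le n$. If $v\geq 1$, then $$\tilde{p}^w_{u,v} = (e^{\varepsilon_{u+1}-\varepsilon_1}-1)\,\tilde{p}^{w-1}_{u-1,v-1}(\varepsilon_2,\dots,\varepsilon_{n+1}) + e^{\varepsilon_{u+2}-\varepsilon_1}\,\tilde{p}^{w-1}_{u,v-1}(\varepsilon_2,\dots,\varepsilon_{n+1}),$$ where $\tilde p^w_{u,v}=(-1)^{u+v+w}p^w_{u,v}$ and $p^w_{u,v}$ are the structure constants of $K_T(\mathbb{P}^n)$ in the basis $\{\xi^u\}$.
   Context: Everything is over $\mathbb{C}$. $G=SL_{n+1}$, $T=\{(t_1,\dots,t_{n+1})\in(\mathbb{C}^* )^{n+1} : \prod t_i=1\}$ is its diagonal maximal torus, acting in the obvious way on $\mathbb{P}^n$ with projective coordinates $[x_1,\dots,x_{n+1}]$. $R(T)$ is the representation ring of $T$, with $\mathbb{Z}$-basis the characters $e^\lambda$. The character $e^{\varepsilon_i}$ is $(t_1,\dots,t_{n+1})\mapsto t_i$, and $\chi_i=\varepsilon_1+\cdots+\varepsilon_i$. For $0\le u\le n$ let $X^u=\{[0,\dots,0,x_{u+1},\dots,x_{n+1}]\}\subset\mathbb{P}^n$ and $X^{n+1}=\emptyset$. $K_T(\mathbb{P}^n)$ is the Grothendieck group of $T$-equivariant coherent sheaves (a ring, being also the Grothendieck group of $T$-equivariant vector bundles). Set $\xi^u=[\mathcal{O}_{X^u}]-[\mathcal{O}_{X^{u+1}}]$; these form an $R(T)$-basis of $K_T(\mathbb{P}^n)$,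 and $p^w_{u,v}\in R(T)$ is defined by $\xi^u\xi^v=\sum_{w=0}^n p^w_{u,v}\xi^w$. Substitution notation: it is a theorem that $$\tilde p^w_{u,v} = e^{\chi_{w+1}-\chi_{u+1}-\chi_{v+1}} \left[\frac{\prod_{i=1}^u (1-te^{\varepsilon_i})\prod_{i=1}^v (1-te^{\varepsilon_i})}{\prod_{i=1}^{w+1} (1-te^{\varepsilon_i})}\right]_{u+v-w+1},$$ where $[\,\cdot\,]_p$ is the coefficient of $t^p$ in the power series expansion at $t=0$. For weights $\mu_1,\mu_2,\dots$ of $T$, $\tilde p^w_{u,v}(\mu_1,\mu_2,\dots)\in R(T)$ denotes the element obtained from this expression by replacing each $\varepsilon_i$ by $\mu_i$. Thus $\tilde p^{w-1}_{a,b}(\varepsilon_2,\dots,\varepsilon_{n+1})$ is obtained from the displayed formula for $\tilde p^{w-1}_{a,b}$ by replacing $\varepsilon_i$ with $\varepsilon_{i+1}$. Conventions: $\tilde p^w_{u,v}=0$ if $u$, $v$ or $w$ is negative; and $\tilde p^{w}_{u,v}$ (and any substitution into it) is $0$ whenever $u>w$ or $v>w$, so in particular the second term on the right-hand side is interpreted as $0$ when $u=n$ (where $\varepsilon_{n+2}$ is not defined). *)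

(* Defs.v *)
From HB Require Import structures.
From mathcomp Require Import all_boot all_order all_algebra.
From mathcomp Require Import finmap.
From mathcomp Require Import boolp.
From mathcomp.multinomials Require Import monalg.
Set Implicit Arguments.
Unset Strict Implicit.
Unset Printing Implicit Defensive.
Import GRing.Theory Num.Theory.
Local Open Scope fset_scope.
Local Open Scope ring_scope.

(** * Characters of the torus *)

(** T is the group of (n+1)-tuples of nonzero scalars t with prod_i t_i = 1.
    Its character group is Z^(n+1) / Z(1,...,1), the class of a row [a]
    being the character t |-> prod_i t_i^(a_i). *)
Section CharacterLattice.
Variable n : nat.

Definition const_rows : {pred 'rV[int]_n.+1} :=
  [pred a : 'rV[int]_n.+1 | [forall i, a ord0 i == a ord0 ord0]].

Fact const_rows_zmod_closed : zmod_closed const_rows.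
Proof.
split=> [|a b /forallP ha /forallP hb]; apply/forallP=> i; rewrite !mxE //.
by rewrite (eqP (ha i)) (eqP (hb i)).
Qed.

HB.instance Definition _ :=
  GRing.isZmodClosed.Build _ const_rows const_rows_zmod_closed.

Definition weight := Quotient.quot const_rows.
HB.instance Definition _ := GRing.Zmodule.on weight.

Definition wt (a : 'rV[int]_n.+1) : weight := (\pi_weight a)%qT.

(** Indices start at 1, and [eps i] is 0 unless 1 <= i <= n+1. *)
Definition eps (i : nat) : weight := wt (\row_j (j.+1 == i)%:R).

End CharacterLattice.

(** * The group ring of an abelian group *)

(** [monalg] has this ring structure only over monoids without invertible
    elements, which excludes groups. *)
Section GroupRing.
Variable G : zmodType.

Definition group_ring := {malg int[G]}.
HB.instance Definition _ := GRing.Zmodule.on group_ring.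

Implicit Types (x y z : group_ring).

Definition gexp (g : G) : group_ring := << 1 *g g >>.

Definition gr_mul x y : group_ring :=
  \sum_(g <- msupp x) \sum_(h <- msupp y) << x@_g * y@_h *g g + h >>.

Lemma gr_mulw (d1 d2 : {fset G}) x y : msupp x `<=` d1 -> msupp y `<=` d2 ->
  gr_mul x y = \sum_(g <- d1) \sum_(h <- d2) << x@_g * y@_h *g g + h >>.
Proof.
move=> le1 le2; rewrite /gr_mul (big_fset_incl _ le1) /=.
  apply/eq_bigr=> g _; apply/big_fset_incl => // h _ /mcoeff_outdom ->.
  by rewrite mulr0 monalgU0.
move=> g _ /mcoeff_outdom xg.
by rewrite big1 => // h _; rewrite xg mul0r monalgU0.
Qed.

Lemma gr_mulC : commutative gr_mul.
Proof.
move=> x y; rewrite /gr_mul exchange_big; apply: eq_bigr => g _.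
by apply: eq_bigr => h _; rewrite mulrC addrC.
Qed.

Lemma gr_mulDl : left_distributive gr_mul +%R.
Proof.
move=> x1 x2 y.
rewrite (@gr_mulw _ _ x1 y (fsubsetUl _ (msupp x2)) (fsubset_refl _)).
rewrite (@gr_mulw _ _ x2 y (fsubsetUr (msupp x1) _) (fsubset_refl _)).
rewrite (@gr_mulw _ _ (x1 + x2) y (msuppD_le _ _) (fsubset_refl _)).
rewrite -big_split /=; apply/eq_bigr=> g _.
rewrite -big_split /=; apply/eq_bigr=> h _.
by rewrite mcoeffD mulrDl monalgUD.
Qed.

Lemma gr_mulDr : right_distributive gr_mul +%R.
Proof. by move=> y x1 x2; rewrite ![gr_mul y _]gr_mulC gr_mulDl. Qed.

Lemma gr_mul0 : left_zero 0 gr_mul.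
Proof. by move=> y; rewrite /gr_mul msupp0 big_seq_fset0. Qed.

Lemma gr_mulUU c1 c2 g h :
  gr_mul << c1 *g g >> << c2 *g h >> = << c1 * c2 *g g + h >>.
Proof.
by rewrite (gr_mulw msuppU_le msuppU_le) !big_seq_fset1 !mcoeffUU.
Qed.

Lemma gr_mul_suml (I : Type) (r : seq I) (f : I -> group_ring) y :
  gr_mul (\sum_(i <- r) f i) y = \sum_(i <- r) gr_mul (f i) y.
Proof.
by apply: (big_morph (gr_mul^~ y)); [move=> ? ?; apply: gr_mulDl | apply: gr_mul0].
Qed.

Lemma gr_mul_sumr (I : Type) (r : seq I) (f : I -> group_ring) x :
  gr_mul x (\sum_(i <- r) f i) = \sum_(i <- r) gr_mul x (f i).
Proof.
by rewrite gr_mulC gr_mul_suml; apply: eq_bigr => i _; rewrite gr_mulC.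
Qed.

Lemma gr_mulA : associative gr_mul.
Proof.
pose u x (g : G) : group_ring := << x@_g *g g >>.
have uE x : x = \sum_(g <- msupp x) u x g by exact: monalgE.
have suml := @gr_mul_suml G; have sumr := @gr_mul_sumr G.
move=> x y z; rewrite (uE x) (suml _ (u x)) (suml _ (u x)) suml.
apply: eq_bigr => g _; rewrite (uE y) (suml _ (u y)) (sumr _ _ (u x g)).
rewrite (sumr _ (u y)) suml; apply: eq_bigr => h _.
rewrite (uE z) (sumr _ (u z)) (sumr _ _ (u x g)) (sumr _ (u z)).
by apply: eq_bigr => l _; rewrite !gr_mulUU mulrA addrA.
Qed.

Lemma gr_mul1 : left_id (gexp 0) gr_mul.
Proof.
move=> x; rewrite [x in LHS]monalgE [RHS]monalgE gr_mul_sumr.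
by apply: eq_bigr => g _; rewrite gr_mulUU mul1r add0r.
Qed.

Lemma gr_one_neq0 : gexp 0 != 0 :> group_ring.
Proof. by rewrite monalgU_eq0 oner_eq0. Qed.

HB.instance Definition _ := GRing.Zmodule_isComNzRing.Build group_ring
  gr_mulA gr_mulC gr_mul1 gr_mulDl gr_one_neq0.

End GroupRing.

(** R(T), with Z-basis the characters [e_ lambda]. *)
Definition repring (n : nat) := group_ring (weight n).
HB.instance Definition _ n := GRing.ComNzRing.on (repring n).

Definition e_ (n : nat) (lambda : weight n) : repring n := gexp lambda.

(** * T-equivariant coherent sheaves on P^n *)

(** P^n is covered by the T-stable affine open sets
    U_I = {x_i != 0 for all i in I}, for I a nonempty set of coordinates, and
    U_I \cap U_J = U_(I \cup J). *)
Definition chart (n : nat) := {I : {set 'I_n.+1} | I != finset.set0}.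

(** A Laurent monomial x^a of degree 0 is regular on U_I when only the x_i with
    i in I have negative exponents. These monomials form a basis of O(U_I).
    As (t.f)(p) = f(t^-1 p), x^a has weight - sum_j a_j eps_j; since sum_j a_j
    is 0, [a] is determined by this weight, so O(U_I) has at most one monomial
    of each weight. *)
Definition monomial_on n (I : chart n) (a : 'rV[int]_n.+1) : Prop :=
  \sum_j a ord0 j = 0 /\ forall j, j \notin val I -> 0 <= a ord0 j.

(** [regular I lambda]: O(U_I) has a monomial of weight [lambda]. *)
Definition regular n (I : chart n) (lambda : weight n) : bool :=
  `[< exists2 a, monomial_on I a & lambda = - wt a >].

Section EquivariantSheaves.
Variables (k : fieldType) (n : nat).
Local Notation weight := (weight n).
Local Notation chart := (chart n).

(** A T-equivariant quasi-coherent sheaf F is a system of X(T)-graded modules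
    F(U_I) over the X(T)-graded rings O(U_I), with F(U_J) the localization of
    F(U_I) for I \subset J: a T-action on a module is a grading by characters.
    When F is coherent every weight space is finite dimensional, as F(U_I) is
    finitely generated and the weight spaces of O(U_I) have dimension at most
    1; up to isomorphism, the weight space F(U_I)_mu is thus the space of rows
    of length [sec F I mu], with linear maps acting by matrices on the right.
    - [act I mu nu] is the multiplication F(U_I)_mu -> F(U_I)_nu by the
      monomial of weight nu - mu, meaningful when [regular I (nu - mu)] only;
    - [res I J mu] is the restriction F(U_I)_mu -> F(U_J)_mu, meaningful when
      I \subset J only. *)
Record sheaf_data := SheafData {
  sec : chart -> weight -> nat;
  act : forall I mu nu, 'M[k]_(sec I mu, sec I nu);
  res : forall I J mu, 'M[k]_(sec I mu, sec J mu)
}.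

Record presheaf_axioms (F : sheaf_data) : Prop := PresheafAxioms {
  act_id : forall I mu, act F I mu mu = 1%:M;
  act_comp : forall I mu nu rho,
    regular I (nu - mu) -> regular I (rho - nu) ->
    act F I mu nu *m act F I nu rho = act F I mu rho;
  res_id : forall I mu, res F I I mu = 1%:M;
  res_comp : forall (I J K : chart) mu,
    val I \subset val J -> val J \subset val K ->
    res F I J mu *m res F J K mu = res F I K mu;
  act_res : forall (I J : chart) mu nu,
    val I \subset val J -> regular I (nu - mu) ->
    act F I mu nu *m res F I J nu = res F I J mu *m act F J mu nu
}.

(** F(U_J) is the localization of F(U_I) at the monomials of O(U_I) that are
    invertible on U_J. *)
Record quasi_coherent (F : sheaf_data) : Prop := QuasiCoherent {
  qc_surj : forall (I J : chart) mu (s : 'rV_(sec F J mu)),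
    val I \subset val J ->
    exists nu, exists t : 'rV_(sec F I nu),
      [/\ regular I (nu - mu), regular J (mu - nu) &
          s *m act F J mu nu = t *m res F I J nu];
  qc_inj : forall (I J : chart) mu (t : 'rV_(sec F I mu)),
    val I \subset val J -> t *m res F I J mu = 0 ->
    exists nu,
      [/\ regular I (nu - mu), regular J (mu - nu) & t *m act F I mu nu = 0]
}.

Definition finitely_generated (F : sheaf_data) : Prop :=
  forall I : chart, exists (r : nat) (lam : 'I_r -> weight)
    (g : forall i, 'rV[k]_(sec F I (lam i))),
  forall mu (s : 'rV_(sec F I mu)), exists c : 'I_r -> k,
    s = \sum_(i | regular I (mu - lam i)) c i *: (g i *m act F I (lam i) mu).

Record coh_sheaf := CohSheaf {
  coh_data :> sheaf_data;
  coh_presheaf : presheaf_axioms coh_data;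
  coh_qc : quasi_coherent coh_data;
  coh_fg : finitely_generated coh_data
}.

Record hom (F G : coh_sheaf) := Hom {
  hom_fun :> forall I mu, 'M[k]_(sec F I mu, sec G I mu);
  hom_act : forall I mu nu, regular I (nu - mu) ->
    act F I mu nu *m hom_fun I nu = hom_fun I mu *m act G I mu nu;
  hom_res : forall (I J : chart) mu, val I \subset val J ->
    res F I J mu *m hom_fun J mu = hom_fun I mu *m res G I J mu
}.

(** 0 -> F -> G -> H -> 0 is exact; the U_I being affine, this can be tested on
    sections. *)
Definition short_exact (F G H : coh_sheaf) (f : hom F G) (g : hom G H) : Prop :=
  forall I mu, [/\ row_free (f I mu), row_full (g I mu) &
                   (f I mu :=: kermx (g I mu))%MS].

(** E is a vector bundle when each E(U_I) is a finitely generated projective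
    O(U_I)-module: there are sections [g i] of weights [lam i] and linear forms
    [phi i : E(U_I) -> O(U_I)] such that s = sum_i (phi i s) (g i) for all s.
    On E(U_I)_mu, [phi i] takes values in the part of O(U_I) of weight
    mu - lam i, identified with scalars through its monomial, or 0. *)
Definition vector_bundle (E : coh_sheaf) : Prop :=
  forall I : chart, exists (r : nat) (lam : 'I_r -> weight)
    (g : forall i, 'rV[k]_(sec E I (lam i)))
    (phi : 'I_r -> forall mu, 'cV[k]_(sec E I mu)),
  [/\ forall i mu, ~~ regular I (mu - lam i) -> phi i mu = 0,
      forall i mu nu, regular I (nu - mu) ->
        act E I mu nu *m phi i nu = phi i mu &
      forall mu,
        \sum_i phi i mu *m (g i *m act E I (lam i) mu) = 1%:M].

Record pairing (E F P : coh_sheaf) := Pairing {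
  pair_fun :> forall I mu nu,
    'rV[k]_(sec E I mu) -> 'rV[k]_(sec F I nu) -> 'rV[k]_(sec P I (mu + nu));
  pair_linl : forall I mu nu (t : 'rV_(sec F I nu)),
    linear (fun s : 'rV_(sec E I mu) => pair_fun s t);
  pair_linr : forall I mu nu (s : 'rV_(sec E I mu)),
    linear (fun t : 'rV_(sec F I nu) => pair_fun s t);
  pair_actl : forall I mu mu' nu (s : 'rV_(sec E I mu)) (t : 'rV_(sec F I nu)),
    regular I (mu' - mu) ->
    pair_fun (s *m act E I mu mu') t
    = pair_fun s t *m act P I (mu + nu) (mu' + nu);
  pair_actr : forall I mu nu nu' (s : 'rV_(sec E I mu)) (t : 'rV_(sec F I nu)),
    regular I (nu' - nu) ->
    pair_fun s (t *m act F I nu nu')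
    = pair_fun s t *m act P I (mu + nu) (mu + nu');
  pair_res : forall (I J : chart) mu nu (s : 'rV_(sec E I mu))
      (t : 'rV_(sec F I nu)),
    val I \subset val J ->
    pair_fun (s *m res E I J mu) (t *m res F I J nu)
    = pair_fun s t *m res P I J (mu + nu)
}.

Arguments pair_fun {E F P} p I mu nu s t.

(** P is a tensor product of E and F. *)
Definition is_tensor (E F P : coh_sheaf) : Prop :=
  exists b : pairing E F P, forall (Q : coh_sheaf) (c : pairing E F Q),
    exists f : hom P Q,
      (forall I mu nu s t, c I mu nu s t = b I mu nu s t *m f I (mu + nu)) /\
      (forall f' : hom P Q,
        (forall I mu nu s t, c I mu nu s t = b I mu nu s t *m f' I (mu + nu)) ->
        forall I mu, f' I mu = f I mu).

(** * The Grothendieck group *)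

Definition free_group := {malg int[{classic coh_sheaf}]}.

Inductive ses_span : free_group -> Prop :=
| ses_span0 : ses_span 0
| ses_spanB x y : ses_span x -> ses_span y -> ses_span (x - y)
| ses_span_exact (F G H : coh_sheaf) (f : hom F G) (g : hom G H) :
    short_exact f g ->
    ses_span (<< 1 *g (G : {classic coh_sheaf}) >>
              - << 1 *g (F : {classic coh_sheaf}) >>
              - << 1 *g (H : {classic coh_sheaf}) >>).

Definition ses_spanb : {pred free_group} := [pred x | `[< ses_span x >]].

Fact ses_spanb_zmod_closed : zmod_closed ses_spanb.
Proof.
split=> [|x y /asboolP hx /asboolP hy]; apply/asboolP; first exact: ses_span0.
exact: ses_spanB.
Qed.

HB.instance Definition _ :=
  GRing.isZmodClosed.Build _ ses_spanb ses_spanb_zmod_closed.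

Definition KT := Quotient.quot ses_spanb.
HB.instance Definition _ := GRing.Zmodule.on KT.

Definition cls (F : coh_sheaf) : KT :=
  (\pi_KT (<< 1 *g (F : {classic coh_sheaf}) >> : free_group))%qT.

(** The multiplication of K_T(P^n): the biadditive law given by the tensor
    product on vector bundles, whose classes generate the group. *)
Record KT_product (mul : KT -> KT -> KT) : Prop := KTProduct {
  mul_addl : forall y, zmod_morphism (fun x => mul x y);
  mul_addr : forall x, zmod_morphism (mul x);
  mul_tensor : forall E F P : coh_sheaf,
    vector_bundle E -> vector_bundle F -> is_tensor E F P ->
    mul (cls E) (cls F) = cls P
}.

End EquivariantSheaves.

(** * The sheaves O_{X^u} *)

Section StructureSheaves.
Variables (k : fieldType) (n : nat).
Local Notation weight := (weight n).
Local Notation chart := (chart n).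
Implicit Types (I J K : chart) (a b c : 'rV[int]_n.+1).

(** X^u is given by x_1 = ... = x_u = 0. It misses U_I if some i <= u is in I;
    otherwise O_{X^u}(U_I) is O(U_I) modulo the monomials containing some x_j
    with j <= u, so that its basis consists of the remaining monomials. *)
Definition monomial_X (u : nat) I a : Prop :=
  monomial_on I a /\
  forall j : 'I_n.+1, (j < u)%N -> j \notin val I /\ a ord0 j = 0.

Definition struct_wt (u : nat) I (lambda : weight) : bool :=
  `[< exists2 a, monomial_X u I a & lambda = - wt a >].

Definition structX_data (u : nat) (lambda : weight) : sheaf_data k n :=
  @SheafData k n (fun I mu => struct_wt u I (mu - lambda))
    (fun I mu nu => const_mx 1) (fun I J mu => const_mx 1).

Let wtD a b : wt (a + b) = wt a + wt b.
Proof. by rewrite /wt raddfD. Qed.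

Let wtN a : wt (- a) = - wt a.
Proof. by rewrite /wt raddfN. Qed.

Let wt0 : wt (0 : 'rV[int]_n.+1) = 0.
Proof. by rewrite /wt raddf0. Qed.

Lemma wt_inj a b :
  \sum_j a ord0 j = 0 -> \sum_j b ord0 j = 0 -> wt a = wt b -> a = b.
Proof.
move=> sa sb /eqP; rewrite /wt -Quotient.idealrBE => /forallP h.
have {}h j : (a - b) ord0 j = (a - b) ord0 ord0 by apply/eqP.
have: \sum_j (a - b) ord0 j = 0.
  under eq_bigr do rewrite !mxE.
  by rewrite sumrB sa sb subrr.
under eq_bigr do rewrite h.
rewrite sumr_const card_ord => /eqP; rewrite mulrn_eq0 /= => /eqP h0.
apply/eqP; rewrite -subr_eq0; apply/eqP/rowP => j.
by rewrite h h0 mxE.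
Qed.

Lemma monomial_on0 I : monomial_on I 0.
Proof.
by split=> [|j _]; rewrite ?mxE // big1 // => j _; rewrite mxE.
Qed.

Lemma monomial_onD I a b :
  monomial_on I a -> monomial_on I b -> monomial_on I (a + b).
Proof.
move=> [sa ha] [sb hb]; split=> [|j hj]; last by rewrite mxE addr_ge0 ?ha ?hb.
by under eq_bigr do rewrite mxE; rewrite big_split /= sa sb addr0.
Qed.

Lemma regular0 I : regular I 0.
Proof.
apply/asboolP; exists 0; first exact: monomial_on0.
by rewrite wt0 oppr0.
Qed.

Lemma struct_wt_regular u I lambda : struct_wt u I lambda -> regular I lambda.
Proof. by case/asboolP=> a [ha _] ->; apply/asboolP; exists a. Qed.

Lemma struct_wt0 u I lambda : struct_wt u I lambda -> struct_wt u I 0.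
Proof.
case/asboolP=> a [_ ha] _; apply/asboolP; exists 0; last by rewrite wt0 oppr0.
split=> [|j /ha[]]; first exact: monomial_on0.
by rewrite mxE.
Qed.

Lemma struct_wt_between u I lam mu nu : struct_wt u I lam ->
  regular I (mu - lam) -> regular I (nu - mu) -> struct_wt u I nu ->
  struct_wt u I mu.
Proof.
case/asboolP=> a [ma ha] ea /asboolP[b mb eb] /asboolP[b' mb' eb'].
case/asboolP=> c [mc hc] ec; apply/asboolP; exists (a + b); last first.
  by rewrite wtD opprD -ea -eb addrC subrK.
split=> [|j ju]; first exact: monomial_onD.
have [jI cj] := hc j ju; split=> //.
have e : c = a + b + b'.
  apply: wt_inj; first by case: mc.
    by case: (monomial_onD (monomial_onD ma mb) mb').
  apply: oppr_inj; rewrite -ec !wtD !opprD -ea -eb -eb'.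
  by rewrite [lam + _]addrC subrK addrC subrK.
have [_ aj] := ha j ju.
have bj : 0 <= b ord0 j by case: mb => _; apply.
have bj' : 0 <= b' ord0 j by case: mb' => _; apply.
move: cj; rewrite e !mxE aj add0r => /eqP.
by rewrite paddr_eq0 // => /andP[/eqP-> _].
Qed.

Lemma struct_wt_mid u I J K lam : val I \subset val J -> val J \subset val K ->
  struct_wt u I lam -> struct_wt u K lam -> struct_wt u J lam.
Proof.
move=> /subsetP IJ /subsetP JK /asboolP[a [[sa na] ha] ea].
case/asboolP=> c [_ hc] _; apply/asboolP; exists a => //.
split=> [|j ju].
  split=> // j jJ; apply: na; apply: contra jJ; exact: IJ.
have [_ aj] := ha j ju; have [jK _] := hc j ju; split=> //.
by apply: contra jK; apply: JK.
Qed.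

Lemma struct_wt_mulres u I J mu nu : val I \subset val J ->
  struct_wt u I mu -> regular I (nu - mu) -> struct_wt u J nu ->
  struct_wt u I nu.
Proof.
move=> /subsetP IJ /asboolP[a [ma ha] ea] /asboolP[b mb eb].
case/asboolP=> c [[sc _] hc] ec; have mab := monomial_onD ma mb.
have e : c = a + b.
  apply: wt_inj => //; first by case: mab.
  by apply: oppr_inj; rewrite -ec wtD opprD -ea -eb addrC subrK.
apply/asboolP; exists c => //; rewrite e; split=> // j ju.
have [jI _] := ha j ju; have [_] := hc j ju; rewrite e; split=> //.
Qed.

Lemma struct_wt_resmul u I J mu nu : val I \subset val J ->
  struct_wt u I mu -> struct_wt u J nu -> struct_wt u J mu.
Proof.
move=> IJ hmu /struct_wt0 hJ.
move/subsetP: IJ => IJ; case/asboolP: hmu => a [[sa na] ha] ea.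
case/asboolP: hJ => c [_ hc] _; apply/asboolP; exists a => //.
split=> [|j ju]; last by split; [case: (hc j ju) | case: (ha j ju)].
by split=> // j jJ; apply: na; apply: contra jJ; apply: IJ.
Qed.

Lemma const_mulmx (p q r : bool) : (p -> r -> q) ->
  (const_mx 1 : 'M[k]_(p, q)) *m (const_mx 1 : 'M[k]_(q, r)) = const_mx 1.
Proof.
case: p q r => [] [] [] h; apply/matrixP=> i j; try by case: i => [[]].
- by rewrite !mxE big_ord1 !mxE mulr1.
- by case: j => [[]].
- by have := h isT isT.
- by case: j => [[]].
Qed.

Lemma const_mx_id (p : bool) : (const_mx 1 : 'M[k]_(p, p)) = 1%:M.
Proof.
by case: p; apply/matrixP=> i j; [rewrite !mxE !ord1 eqxx | case: i => [[]]].
Qed.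

Lemma row_false (p : bool) : ~~ p -> forall s : 'rV[k]_p, s = 0.
Proof. by case: p => // _ s; apply: thinmx0. Qed.

Let shiftB (nu mu lambda : weight) : nu - lambda - (mu - lambda) = nu - mu.
Proof. by rewrite opprB addrA subrK. Qed.

Lemma structX_presheaf u lambda : presheaf_axioms (structX_data u lambda).
Proof.
split=> /=.
- by move=> I mu; rewrite const_mx_id.
- move=> I mu nu rho r1 r2; apply: const_mulmx => h1 h2.
  by apply: (struct_wt_between h1 _ _ h2); rewrite shiftB.
- by move=> I mu; rewrite const_mx_id.
- move=> I J K mu IJ JK; apply: const_mulmx; exact: struct_wt_mid IJ JK.
- move=> I J mu nu IJ r; rewrite !const_mulmx // => h1 h2.
    exact: (struct_wt_resmul IJ h1 h2).
  by apply: (struct_wt_mulres IJ h1 _ h2); rewrite shiftB.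
Qed.

Let unit_row (j : 'I_n.+1) : 'rV[int]_n.+1 := \row_i (i == j)%:R.

Let sum_unit j : \sum_i unit_row j ord0 i = 1.
Proof.
rewrite (bigD1 j) //= !mxE eqxx big1 ?addr0 // => i ij.
by rewrite mxE (negbTE ij).
Qed.

Lemma structX_qc u lambda : quasi_coherent (structX_data u lambda).
Proof.
split=> /= [I J mu s IJ|I J mu t IJ].
- have /orP[/asboolP[a [[sa na] ha] ea]|nJ] := orbN (struct_wt u J (mu - lambda));
    last first.
    exists mu; exists 0; rewrite subrr; split; try exact: regular0.
    rewrite mul0mx; by rewrite (row_false nJ s) mul0mx.
  have /set0Pn[i iI] := valP I.
  pose m j : int := ((j \in val J) && (j \notin val I))%:R * `|a ord0 j|.
  pose b := \row_j m j - (\sum_j m j) *: unit_row i.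
  have sb : \sum_j b ord0 j = 0.
    under eq_bigr do rewrite /b mxE [X in X + _]mxE mxE mxE.
    by rewrite sumrB -mulr_sumr sum_unit mulr1 subrr.
  have bE j : j \notin val I -> b ord0 j = m j.
    move=> jI; rewrite !mxE (_ : (j == i) = false) ?mulr0 ?subr0 //.
    by apply: contraNF jI => /eqP->.
  have mb : monomial_on I b.
    by split=> // j jI; rewrite bE // mulr_ge0 // ler0n.
  have mb' : monomial_on J (- b).
    split=> [|j jJ]; first by under eq_bigr do rewrite mxE; rewrite sumrN sb oppr0.
    rewrite mxE bE; last by apply: contra jJ; apply: (subsetP IJ).
    by rewrite /m (negbTE jJ) mul0r oppr0.
  pose nu := mu - wt b.
  have nI : struct_wt u I (nu - lambda).
    apply/asboolP; exists (a + b); last first.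
      by rewrite wtD opprD -ea /nu addrAC.
    split; last first.
      move=> j ju; have [jJ aj] := ha j ju; have jI : j \notin val I.
        by apply: contra jJ; apply: (subsetP IJ).
      by split=> //; rewrite mxE aj add0r bE // /m (negbTE jJ) mul0r.
    split=> [|j jI].
      by under eq_bigr do rewrite mxE; rewrite big_split /= sa sb addr0.
    rewrite mxE bE // /m jI andbT; case: (boolP (j \in val J)) => jJ.
      by rewrite mul1r -lerBlDl sub0r lerNl; case: (ger0P (a ord0 j)) => h;
        rewrite ?opprK // -subr_ge0 ?opprK // addr_ge0.
    by rewrite mul0r addr0 na.
  exists nu; exists (s *m const_mx 1); split.
  + by rewrite /nu addrAC subrr add0r; apply/asboolP; exists b.
  + rewrite /nu opprB addrC subrK; apply/asboolP; exists (- b) => //.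
    by rewrite wtN opprK.
  + by rewrite -mulmxA const_mulmx.
- move=> t0.
  have /orP[hJ|nJ] := orbN (struct_wt u J (mu - lambda)).
    exists mu; rewrite subrr; split; try exact: regular0.
    set q := struct_wt u J (mu - lambda) in hJ t0.
    by rewrite -(@const_mulmx _ q _ (fun _ _ => hJ)) mulmxA t0 mul0mx.
  have /orP[hI|nI] := orbN (struct_wt u I (mu - lambda)); last first.
    exists mu; rewrite subrr; split; try exact: regular0.
    by rewrite (row_false nI t) mul0mx.
  have /set0Pn[i iI] := valP I.
  case/asboolP: (hI) => a [[sa na] ha] ea.
  have [j /andP[ju jJ]] : exists j : 'I_n.+1, (j < u)%N && (j \in val J).
    apply/existsP; apply: contraNT nJ; rewrite negb_exists => /forallP h.
    apply/asboolP; exists a => //; split.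
      by split=> // j jJ; apply: na; apply: contra jJ; apply: (subsetP IJ).
    move=> j ju; split; last by case: (ha j ju).
    by have := h j; rewrite ju.
  have [jI aj] := ha j ju.
  pose b := unit_row j - unit_row i.
  have sb : \sum_l b ord0 l = 0.
    under eq_bigr do rewrite /b mxE [X in _ + X]mxE.
    by rewrite sumrB !sum_unit subrr.
  have bE l : l != i -> b ord0 l = (l == j)%:R.
    by move=> li; rewrite !mxE (negbTE li) subr0.
  have bI l : l \notin val I -> l != i by apply: contra => /eqP->.
  have mb : monomial_on I b.
    by split=> // l lI; rewrite bE ?bI // ler0n.
  exists (mu - wt b); split.
  + by rewrite addrAC subrr add0r; apply/asboolP; exists b.
  + rewrite opprB addrC subrK; apply/asboolP; exists (- b); last first.
      by rewrite wtN opprK.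
    split=> [|l lJ]; first by under eq_bigr do rewrite mxE; rewrite sumrN sb oppr0.
    rewrite mxE bE; last by rewrite bI //; apply: contra lJ; apply: (subsetP IJ).
    by rewrite (_ : (l == j) = false) ?oppr0 //; apply: contraNF lJ => /eqP->.
  + have : ~~ struct_wt u I (mu - wt b - lambda).
      apply/negP => /asboolP[c [[sc _] hc] ec]; have [_] := hc j ju.
      have -> : c = a + b.
        apply: wt_inj => //.
          by under eq_bigr do rewrite mxE; rewrite big_split /= sa sb addr0.
        by apply: oppr_inj; rewrite -ec wtD opprD -ea addrAC.
      by rewrite mxE aj add0r bE ?bI // eqxx.
    by move=> nn; exact: row_false.
Qed.

Lemma structX_fg u lambda : finitely_generated (structX_data u lambda).
Proof.
move=> I; exists 1%N, (fun=> lambda), (fun=> const_mx 1) => mu s.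
have /orP[h|h] := orbN (struct_wt u I (mu - lambda)); last first.
  by exists (fun=> 0); rewrite [LHS](row_false h) [RHS](row_false h).
have h0 : struct_wt u I (lambda - lambda) by rewrite subrr (struct_wt0 h).
exists (fun=> \sum_j s ord0 j).
rewrite big_mkcond big_ord1 (struct_wt_regular h) /=.
rewrite (_ : const_mx 1 = const_mx 1 :> 'M_(true, _)) //.
rewrite (const_mulmx (p := true)) //; apply/rowP=> j.
by move: s j; rewrite /= h => s j; rewrite !mxE big_ord1 mulr1 !ord1.
Qed.

(** O_{X^u} twisted by the character [lambda]; it is 0 for u = n+1, where X^u is
    empty. *)
Definition structX (u : nat) (lambda : weight) : coh_sheaf k n :=
  CohSheaf (structX_presheaf u lambda) (structX_qc u lambda)
           (structX_fg u lambda).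

Definition xi (u : nat) : KT k n := cls (structX u 0) - cls (structX u.+1 0).

(** The homomorphism R(T) -> K_T(P^n) making K_T(P^n) an R(T)-algebra: it maps
    a representation V to the class of the trivial bundle with fibre V. *)
Definition from_repring (p : repring n) : KT k n :=
  \sum_(lambda <- msupp p) cls (structX 0 lambda) *~ (p@_lambda).

(** [p u v w] is the coefficient of xi^w in xi^u xi^v. *)
Definition structure_constants (mul : KT k n -> KT k n -> KT k n)
    (p : nat -> nat -> nat -> repring n) : Prop :=
  forall u v, (u <= n)%N -> (v <= n)%N ->
  mul (xi u) (xi v) = \sum_(0 <= w < n.+1) mul (from_repring (p u v w)) (xi w).

End StructureSheaves.

(** * The expressions \tilde p^w_{u,v}(mu_1, mu_2, ...) *)

(** The coefficient of t^i in the power series P / Q, for Q(0) = 1: then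
    1/Q = sum_j (1 - Q)^j, where the terms with j > i are O(t^(i+1)). *)
Definition quot_coef (A : comNzRingType) (P Q : {poly A}) (i : int) : A :=
  if i is Posz i then (P * \sum_(j < i.+1) (1 - Q) ^+ j)`_i else 0.

Section TildeP.
Variables (n : nat) (mu : nat -> weight n).

Definition chi (i : nat) : weight n := \sum_(1 <= j < i.+1) mu j.

Definition linprod (i : nat) : {poly repring n} :=
  \prod_(1 <= j < i.+1) (1 - e_ (mu j) *: 'X).

Definition ptilde_at (u v w : int) : repring n :=
  match u, v, w with
  | Posz u, Posz v, Posz w =>
      if (u <= w)%N && (v <= w)%N then
        e_ (chi w.+1 - chi u.+1 - chi v.+1)
        * quot_coef (linprod u * linprod v) (linprod w.+1)
                    (u%:Z + v%:Z - w%:Z + 1)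
      else 0
  | _, _, _ => 0
  end.

End TildeP.

(* Main.v *)
Require Import Defs.
From HB Require Import structures.
From mathcomp Require Import all_boot all_order all_algebra.
From mathcomp Require Import finmap boolp.
From mathcomp.multinomials Require Import monalg.
From mathcomp Require Import zify ring.
Set Implicit Arguments.
Unset Strict Implicit.
Unset Printing Implicit Defensive.
Import Order.TTheory GRing.Theory Num.Theory.
Local Open Scope fset_scope.
Local Open Scope ring_scope.

(** Write [t = [O(-1)]] and [s = 1/t]. The sequences
    0 -> O_{X^u}(d-1) e^(lam - eps_(u+1)) -> O_{X^u}(d) e^lam
      -> O_{X^(u+1)}(d) e^lam -> 0
    express every class in terms of line bundles, giving
    [O_{X^u}] = prod_(i <= u) (1 - t e^(-eps_i)), hence
    (-1)^u xi^u = s^(-u-1) e^(-chi_(u+1)) L_u(s),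
    with L_u = prod_(i <= u) (1 - s e^(eps_i)),
    while [O_{X^(n+1)}] = 0 gives L_(n+1)(s) = 0. Tensor products of line bundles
    being line bundles, xi^u xi^v can be computed in R(T)[t, 1/t]. There,
    dividing L_u L_v successively by 1 - s e^(eps_1), 1 - s e^(eps_2), ... yields
    L_u L_v = sum_w [L_u L_v / L_(w+1)]_(u+v-w+1) s^(u+v-w+1) L_w modulo L_(n+1),
    which is the closed formula for the structure constants. The xi^w are
    independent over R(T) because dimensions of weight spaces are additive: on
    the chart x_(w+1) <> 0 the class xi^v vanishes for v > w, and the sections of
    xi^w form a pointed cone of weights, so convolution with it is injective.
    The recursion follows by cancelling 1 - s e^(eps_1) in the closed formula. *)

(** * Additive maps out of a group ring *)

Section Lift.
Variables (K : choiceType) (M : zmodType).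
Implicit Types (f : K -> M) (x y : {malg int[K]}).

(** The additive extension of [f] to the free abelian group on [K]. Ring maps, the map to K-theory
    and dimension counts are all built from it. *)
Definition lift f x : M := \sum_(g <- msupp x) f g *~ x@_g.

Lemma liftw f x (d : {fset K}) :
  msupp x `<=` d -> lift f x = \sum_(g <- d) f g *~ x@_g.
Proof.
move=> le; rewrite /lift (big_fset_incl _ le) //= => g _ /mcoeff_outdom ->.
by rewrite mulr0z.
Qed.

Fact lift_is_additive f : zmod_morphism (lift f).
Proof.
move=> x y; rewrite (liftw f (msuppB_le x y)) (liftw f (fsubsetUl (msupp x) (msupp y))).
rewrite (liftw f (fsubsetUr (msupp x) (msupp y))) -sumrB.
by apply: eq_bigr => g _; rewrite mcoeffB mulrzBr.
Qed.

HB.instance Definition _ f :=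
  GRing.isZmodMorphism.Build {malg int[K]} M (lift f) (lift_is_additive f).

Lemma liftU f c g : lift f << c *g g >> = f g *~ c.
Proof. by rewrite (liftw f msuppU_le) big_seq_fset1 mcoeffUU. Qed.

Lemma lift_uniq f (h : {additive {malg int[K]} -> M}) x :
  (forall g, h << 1 *g g >> = f g) -> h x = lift f x.
Proof.
move=> hf; rewrite [in LHS](monalgE x) raddf_sum; apply: eq_bigr => g _.
have -> : << x@_g *g g >> = << 1 *g g >> *~ x@_g :> {malg int[K]}.
  by rewrite -(raddfMz (mkmalgU g)) intz.
by rewrite raddfMz hf.
Qed.

End Lift.

Lemma lift_comp (K : choiceType) (M N : zmodType) (f : K -> M)
    (h : {additive M -> N}) x : h (lift f x) = lift (h \o f) x.
Proof.
by rewrite raddf_sum; apply: eq_bigr => g _; rewrite raddfMz.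
Qed.

Lemma eq_lift (K : choiceType) (M : zmodType) (f f' : K -> M) x :
  f =1 f' -> lift f x = lift f' x.
Proof. by move=> e; apply: eq_bigr => g _; rewrite e. Qed.

Section GroupRingLift.
Variables (G : zmodType).

Lemma gexpD (g h : G) : gexp (g + h) = gexp g * gexp h.
Proof. by rewrite [RHS]gr_mulUU mulr1. Qed.

Lemma lift_gexp (M : zmodType) (f : G -> M) g : lift f (gexp g) = f g.
Proof. by rewrite liftU. Qed.

Lemma gexpE (x : group_ring G) : x = lift (@gexp G) x.
Proof. by rewrite -(@lift_uniq _ _ _ (GRing.Additive.clone _ _ idfun _)). Qed.

(** Biadditivity reduces the claim to basis elements. The law on [M] is a bare biadditive map, so
    that the product of [KT] can be taken for it. *)
Lemma lift_mul (M : zmodType) (mul : M -> M -> M) (f : G -> M)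
    (addl : forall y, zmod_morphism (mul^~ y))
    (addr : forall x, zmod_morphism (mul x)) :
  (forall g h, mul (f g) (f h) = f (g + h)) ->
  forall x y : group_ring G, mul (lift f x) (lift f y) = lift f (x * y).
Proof.
move=> fD x y.
pose al z : {additive M -> M} :=
  HB.pack (mul^~ z) (GRing.isZmodMorphism.Build _ _ (mul^~ z) (addl z)).
pose ar z : {additive M -> M} :=
  HB.pack (mul z) (GRing.isZmodMorphism.Build _ _ (mul z) (addr z)).
rewrite [RHS]raddf_sum [LHS](raddf_sum (al (lift f y))).
apply: eq_bigr => g _; rewrite raddf_sum (raddfMz (al _)) /=.
rewrite [mul _ _](raddf_sum (ar (f g))) mulrz_suml; apply: eq_bigr => h _.
by rewrite (raddfMz (ar _)) /= fD liftU mulrzA mulrzAC.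
Qed.
End GroupRingLift.

(** * Coefficients of quotients of power series *)

Arguments quot_coef : simpl never.

Section QuotCoef.
Variable A : comNzRingType.
Implicit Types (P Q H R : {poly A}) (a : nat -> A).

(** The sum telescopes to 1 - (1 - Q)^N, and 1 - Q is divisible by X: the truncated series inverts Q
    modulo X^N. *)
Lemma geom_seriesM Q N : Q`_0 = 1 ->
  exists R, (\sum_(j < N) (1 - Q) ^+ j) * Q = 1 + 'X^N * R.
Proof.
move=> Q0; have /factor_theorem[U eU] : root (1 - Q) 0.
  by rewrite /root horner_coef0 coefB coef1 Q0 subrr.
rewrite subr0 in eU.
exists (- U ^+ N); have := subrX1 (1 - Q) N.
rewrite {1}eU exprMn addrAC subrr sub0r mulNr => /(congr1 -%R).
by rewrite opprK opprB [Q * _]mulrC => <-; rewrite mulrN [U ^+ N * _]mulrC.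
Qed.

(** A coefficient of P / Q can be read off from any congruence P = H Q modulo X^(i+1), so later
    computations stay among polynomials. *)
Lemma quot_coef_uniq P Q H R (i : nat) : Q`_0 = 1 ->
  P = H * Q + 'X^(i.+1) * R -> quot_coef P Q i = H`_i.
Proof.
move=> Q0 ->; rewrite /quot_coef; have [S eS] := geom_seriesM i.+1 Q0.
rewrite mulrDl -mulrA [Q * _]mulrC eS mulrDr mulr1 -mulrA [H * _]mulrCA -addrA.
by rewrite -mulrDr coefD coefXnM ltnSn addr0.
Qed.

Lemma quot_coefP P Q N : Q`_0 = 1 ->
  exists H R, P = H * Q + 'X^N * R.
Proof.
move=> Q0; have [S eS] := geom_seriesM N Q0.
exists (P * \sum_(j < N) (1 - Q) ^+ j), (- (S * P)).
by rewrite -mulrA eS; ring.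
Qed.

Lemma quot_coef_mulQ H Q (i : nat) : Q`_0 = 1 -> quot_coef (H * Q) Q i = H`_i.
Proof. by move=> Q0; apply: (@quot_coef_uniq _ _ _ 0); rewrite ?mulr0 ?addr0. Qed.

Lemma quot_coef_cancel P Q (S : {poly A}) (i : int) : Q`_0 = 1 -> S`_0 = 1 ->
  quot_coef (S * P) (S * Q) i = quot_coef P Q i.
Proof.
case: i => // i Q0 S0; have [H [R eP]] := quot_coefP P i.+1 Q0.
rewrite (quot_coef_uniq Q0 eP); apply: (@quot_coef_uniq _ _ _ (S * R)).
  by rewrite coef0M Q0 S0 mulr1.
by rewrite eP; ring.
Qed.

Lemma quot_coef_lin P Q c (i : int) : Q`_0 = 1 ->
  quot_coef ((1 - c *: 'X) * P) Q i = quot_coef P Q i - c * quot_coef P Q (i - 1).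
Proof.
move=> Q0; case: i => [i|i]; last by rewrite /= mulr0 subr0.
have [H [R eP]] := quot_coefP P i.+1 Q0.
rewrite (quot_coef_uniq Q0 eP).
have -> : quot_coef ((1 - c *: 'X) * P) Q i = ((1 - c *: 'X) * H)`_i.
  apply: (@quot_coef_uniq _ _ _ ((1 - c *: 'X) * R)) => //.
  by rewrite eP; ring.
rewrite mulrBl mul1r -scalerAl coefB coefZ coefXM.
(* At index 0 the second term vanishes on both sides, [quot_coef] being 0 at index -1. *)
case: i eP => [|i] eP //; congr (_ - _ * _).
have -> : i.+1%:Z - 1 = i by lia.
by rewrite (@quot_coef_uniq _ _ H ('X * R)) // mulrA -exprSr.
Qed.

Definition linear_prod a w : {poly A} := \prod_(1 <= j < w.+1) (1 - a j *: 'X).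

Lemma linear_prod0 a : linear_prod a 0 = 1. Proof. by rewrite /linear_prod big_nil. Qed.

Lemma linear_prodS a w : linear_prod a w.+1 = (1 - a w.+1 *: 'X) * linear_prod a w.
Proof. by rewrite /linear_prod big_nat_recr //= mulrC. Qed.

Lemma coef0_linear c : (1 - c *: 'X : {poly A})`_0 = 1.
Proof. by rewrite coefB coef1 coefZ coefX mulr0 subr0. Qed.

Lemma coef0_linear_prod a w : (linear_prod a w)`_0 = 1.
Proof.
elim: w => [|w IH]; rewrite ?linear_prod0 ?coef1 //.
by rewrite linear_prodS coef0M IH coef0_linear mulr1.
Qed.

(** Division by ascending powers: 1 - c X has constant term 1 while c may fail to be invertible, so
    the remainder sits in the top degree. *)
Lemma linear_divide c (H : {poly A}) N : (size H <= N.+1)%N ->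
  exists (K : {poly A}) d, (size K <= N)%N /\ H = (1 - c *: 'X) * K + d *: 'X^N.
Proof.
elim: N H => [|N IH] H sH.
  exists 0, H`_0; rewrite size_poly0 mulr0 add0r expr0 alg_polyC; split=> //.
  exact: size1_polyC.
pose e := H`_N.+1.
have [|K [d [sK eK]]] := IH (H - e *: 'X^(N.+1)).
  apply/leq_sizeP => j; rewrite leq_eqVlt => /orP[/eqP<-|jN].
    by rewrite coefB coefZ coefXn eqxx mulr1 subrr.
  rewrite coefB coefZ coefXn gtn_eqF // mulr0 subr0.
  by move/leq_sizeP: sH => ->.
(* The previous remainder is absorbed through d X^N = (1 - c X) d X^N + c d X^(N+1). *)
exists (K + d *: 'X^N), (c * d + e); split.
  apply: leq_trans (size_polyD _ _) _; rewrite geq_max (leq_trans sK) //=.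
  by rewrite (leq_trans (size_scale_leq _ _)) // size_polyXn.
rewrite -[H in LHS](subrK (e *: 'X^(N.+1))) eK exprS -!mul_polyC polyCD polyCM.
by ring.
Qed.

(* The partial quotient [H] of [F] by [linear_prod a k] is found one factor at a time:
   dividing by [1 - a k.+1 *: 'X] leaves the top coefficient as remainder. *)
Lemma linear_prod_expansion a (F : {poly A}) m k :
  (size F <= m.+1)%N -> (k <= m.+1)%N ->
  exists H : {poly A}, (size H <= m.+1 - k)%N /\
    F = linear_prod a k * H + \sum_(0 <= w < k)
          quot_coef F (linear_prod a w.+1) (m - w)%N *: ('X^(m - w) * linear_prod a w).
Proof.
move=> sF; elim: k => [_|k IH km].
  by exists F; rewrite linear_prod0 mul1r big_nil addr0 subn0.
have [H [sH eF]] := IH (ltnW km); rewrite subSn // in sH.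
have [K [d [sK eH]]] := linear_divide (a k.+1) sH.
exists K; split; first by rewrite subSS.
(* The terms already split off have w < k, so they carry X^(m-w) with m - w > m - k and do not
   affect the coefficient of degree m - k. *)
have [S eS] : exists S, F = linear_prod a k * H + 'X^((m - k).+1) * S.
  exists (\sum_(0 <= w < k) quot_coef F (linear_prod a w.+1) (m - w)%N *:
            ('X^(k - w.+1) * linear_prod a w)).
  rewrite {1}eF mulr_sumr; congr (_ + _).
  apply: eq_big_nat => w /andP[_ wk]; rewrite -scalerAr mulrA -exprD.
  by congr (_ *: ('X^_ * _)); lia.
rewrite big_nat_recr //=.
(* With L_i for [linear_prod a i], L_k and L_(k+1) agree modulo X, so F is L_(k+1) (K + d X^(m-k))
   modulo X^(m-k+1). As [K] has size at most m - k, the coefficient is [d]. *)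
have -> : quot_coef F (linear_prod a k.+1) (m - k)%N = (K + d *: 'X^(m - k))`_(m - k).
  apply: (@quot_coef_uniq _ _ _ ((a k.+1 * d) *: linear_prod a k + S)).
    exact: coef0_linear_prod.
  by rewrite eS eH linear_prodS exprS -!mul_polyC polyCM; ring.
rewrite coefD coefZ coefXn eqxx mulr1.
rewrite nth_default // add0r {1}eF eH linear_prodS -!mul_polyC; ring.
Qed.

Lemma linear_prod_shift a u :
  linear_prod a u.+1 = (1 - a 1%N *: 'X) * linear_prod (fun i => a i.+1) u.
Proof. by rewrite /linear_prod big_ltn // big_add1. Qed.

(** The factor 1 - a_1 X occurs once above and once below, and cancels completely. *)
Lemma quot_coef_shift0 a v w (i : int) :
  quot_coef (linear_prod a 0 * linear_prod a v.+1) (linear_prod a w.+2) i =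
  quot_coef (linear_prod (fun i => a i.+1) 0 * linear_prod (fun i => a i.+1) v)
    (linear_prod (fun i => a i.+1) w.+1) i.
Proof.
rewrite !(linear_prod_shift a) !linear_prod0 !mul1r quot_coef_cancel //.
  exact: coef0_linear_prod.
exact: coef0_linear.
Qed.

(** The factor 1 - a_1 X occurs twice above and once below; the surviving copy produces the two
    terms. *)
Lemma quot_coef_shiftS a u v w (i : int) :
  let b j := a j.+1 in
  let g := quot_coef (linear_prod b u * linear_prod b v) (linear_prod b w.+1) in
  quot_coef (linear_prod a u.+1 * linear_prod a v.+1) (linear_prod a w.+2) i =
  g i - a 1%N * g (i - 1).
Proof.
have c0 := coef0_linear_prod (fun j => a j.+1) w.+1.
rewrite /= !(linear_prod_shift a) -mulrA mulrCA mulrCA quot_coef_cancel //; last first.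
  exact: coef0_linear.
by rewrite [_ * ((1 - _) * _)]mulrCA quot_coef_lin.
Qed.

Lemma quot_coef_stepS a u v w (i : int) :
  let g := quot_coef (linear_prod a u * linear_prod a v) (linear_prod a w) in
  quot_coef (linear_prod a u.+1 * linear_prod a v) (linear_prod a w) i =
  g i - a u.+1 * g (i - 1).
Proof. by rewrite /= linear_prodS -mulrA quot_coef_lin // coef0_linear_prod. Qed.

End QuotCoef.

(** * The sheaves O_{X^u}(d) *)

Section Weights.
Variable n : nat.
Local Notation weight := (weight n).
Local Notation chart := (chart n).
Implicit Types (I J : chart) (a b : 'rV[int]_n.+1) (i j o : 'I_n.+1) (d : int).

Lemma wtD a b : wt (a + b) = wt a + wt b.
Proof. by rewrite /wt raddfD. Qed.

Lemma wtN a : wt (- a) = - wt a.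
Proof. by rewrite /wt raddfN. Qed.

Lemma wtMz a d : wt (a *~ d) = wt a *~ d.
Proof. by rewrite /wt raddfMz. Qed.

Definition deg a := \sum_j a ord0 j.

Lemma degD a b : deg (a + b) = deg a + deg b.
Proof. by rewrite /deg -big_split; apply: eq_bigr => j _; rewrite mxE. Qed.

Lemma degN a : deg (- a) = - deg a.
Proof. by rewrite /deg -sumrN; apply: eq_bigr => j _; rewrite mxE. Qed.

Lemma deg0 : deg 0 = 0.
Proof. by rewrite /deg big1 // => j _; rewrite mxE. Qed.

(** The kernel of [wt] is spanned by (1,...,1), whose nonzero multiples have nonzero degree. *)
Lemma wt_deg_inj a b : deg a = deg b -> wt a = wt b -> a = b.
Proof.
move=> sab wab; apply/eqP; rewrite -subr_eq0; apply/eqP/wt_inj.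
- by rewrite -/(deg _) degD degN sab subrr.
- exact: deg0.
- by rewrite wtD wtN wab subrr /wt raddf0.
Qed.

Definition unit_row i : 'rV[int]_n.+1 := \row_j (j == i)%:R.

Lemma wt_unit_row i : wt (unit_row i) = eps n i.+1.
Proof. by []. Qed.

Lemma unit_rowMz i d j : (unit_row i *~ d) ord0 j = (j == i)%:R * d.
Proof. by rewrite -scaler_int !mxE intz mulrC. Qed.

Lemma deg_unitMz i d : deg (unit_row i *~ d) = d.
Proof.
rewrite /deg (bigD1 i) //= unit_rowMz eqxx mul1r big1 ?addr0 // => j ji.
by rewrite unit_rowMz (negbTE ji) mul0r.
Qed.

(* [x^a] is a section over [U_I] of the structure sheaf of [X^u], up to twist. *)
Definition mon_ok u I a : bool :=
  [forall j, ((j \notin val I) ==> (0 <= a ord0 j)) &&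
             ((j < u)%N ==> (j \notin val I) && (a ord0 j == 0))].

Lemma mon_okP u I a :
  reflect (forall j, (j \notin val I -> 0 <= a ord0 j) /\
             ((j < u)%N -> j \notin val I /\ a ord0 j = 0)) (mon_ok u I a).
Proof.
apply: (iffP forallP) => h j.
  have /andP[/implyP h1 /implyP h2] := h j.
  by split=> // ju; have /andP[? /eqP] := h2 ju.
have [h1 h2] := h j; apply/andP; split; apply/implyP => // ju.
by have [-> ->] := h2 ju; rewrite eqxx.
Qed.

(* The weights of the sections of O_{X^u}(d) over [U_I], where O(d) is spanned
   by the Laurent monomials of degree [d]. *)
Definition tw_wt u d I (lam : weight) : bool :=
  `[< exists2 a, deg a = d /\ mon_ok u I a & lam = - wt a >].

Lemma tw_wtE u d I a : deg a = d -> tw_wt u d I (- wt a) = mon_ok u I a.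
Proof.
move=> da; apply/asboolP/idP => [[b [db ok]] /oppr_inj e|ok]; last by exists a.
by rewrite (wt_deg_inj _ e) // da db.
Qed.

Lemma struct_wtE u I lam : struct_wt u I lam = tw_wt u 0 I lam.
Proof.
apply: asbool_equiv_eq; split=> [[a [[da ha] hu] e]|[a [da /mon_okP h] e]].
  exists a => //; split=> //; apply/mon_okP => j.
  by split; [apply: ha | apply: hu].
by exists a => //; split=> [|j ju]; [split=> // j jI|]; case: (h j); auto.
Qed.

Lemma regularE I lam : regular I lam = tw_wt 0 0 I lam.
Proof.
apply: asbool_equiv_eq; split=> [[a [da ha] e]|[a [da /mon_okP h] e]].
  by exists a => //; split=> //; apply/mon_okP => j; split=> //; apply: ha.
by exists a => //; split=> // j jI; case: (h j); auto.
Qed.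

(** For i in I, x_i is invertible on U_I, and dividing by x_i^d, of weight -d eps_i, trivializes
    O(d). Ordinals start at 0, hence [i.+1]. *)
Lemma tw_wt_untwist u d I i lam : i \in val I ->
  tw_wt u d I lam = struct_wt u I (lam + eps n i.+1 *~ d).
Proof.
move=> iI; have okE a c : mon_ok u I (a + unit_row i *~ c) = mon_ok u I a.
  apply: eq_forallb => j; have [->|ji] := eqVneq j i.
    by rewrite iI.
  by rewrite mxE unit_rowMz (negbTE ji) mul0r addr0.
rewrite struct_wtE; apply: asbool_equiv_eq; split=> -[a [da ok] e].
  exists (a + unit_row i *~ (- d)); first by rewrite degD deg_unitMz da subrr okE.
  by rewrite e wtD wtMz wt_unit_row mulrNz opprB addrC.
exists (a + unit_row i *~ d); first by rewrite degD deg_unitMz da add0r okE.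
by rewrite wtD wtMz wt_unit_row opprD -e addrK.
Qed.

Lemma chart_pt I : exists i, i \in val I.
Proof. by have /finset.set0Pn[i] := valP I; exists i. Qed.

End Weights.

(** * O_{X^u}(d) as a coherent sheaf *)

Section Cells.
Variables (k : fieldType) (n : nat).
Local Notation weight := (weight n).
Local Notation chart := (chart n).
Implicit Types (I J K : chart) (S : chart -> weight -> bool) (d : int).

(** Sheaves with weight spaces of dimension at most 1: [S] tells which are nonzero, and in the
    monomial bases every structure map is 1. *)
Definition cell_data S : sheaf_data k n :=
  @SheafData k n (fun I mu => S I mu) (fun I mu nu => const_mx 1)
    (fun I J mu => const_mx 1).

Definition tw_supp u d (lam : weight) I mu := tw_wt u d I (mu - lam).

Lemma tw_suppE u d lam I i mu : i \in val I ->
  tw_supp u d lam I mu = struct_wt u I (mu - (lam - eps n i.+1 *~ d)).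
Proof. by move=> iI; rewrite /tw_supp (tw_wt_untwist _ _ _ iI) opprB addrAC addrA. Qed.

Let shiftB (nu mu lambda : weight) : nu - lambda - (mu - lambda) = nu - mu.
Proof. by rewrite opprB addrA subrK. Qed.

Lemma tw_between u d lam I mu nu rho :
  regular I (nu - mu) -> regular I (rho - nu) ->
  tw_supp u d lam I mu -> tw_supp u d lam I rho -> tw_supp u d lam I nu.
Proof.
have [i iI] := chart_pt I; rewrite !(tw_suppE _ _ _ _ iI) => r1 r2 h1 h2.
by apply: (struct_wt_between h1 _ _ h2); rewrite shiftB.
Qed.

Lemma tw_presheaf u d lam : presheaf_axioms (cell_data (tw_supp u d lam)).
Proof.
split=> /=.
- by move=> I mu; rewrite const_mx_id.
- by move=> I mu nu rho r1 r2; apply: const_mulmx; apply: tw_between.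
- by move=> I mu; rewrite const_mx_id.
- move=> I J K mu IJ JK; apply: const_mulmx; have [i iI] := chart_pt I.
  (* A coordinate of the smallest index set lies in the larger ones, so one trivialization serves on
     all the charts. *)
  have iJ := subsetP IJ _ iI; have iK := subsetP JK _ iJ.
  by rewrite !(@tw_suppE _ _ _ _ i) //; apply: struct_wt_mid IJ JK.
- move=> I J mu nu IJ r; have [i iI] := chart_pt I.
  have iJ := subsetP IJ _ iI.
  rewrite !const_mulmx //; rewrite !(@tw_suppE _ _ _ _ i) // => h1 h2.
    exact: (struct_wt_resmul IJ h1 h2).
  by apply: (struct_wt_mulres IJ h1 _ h2); rewrite shiftB.
Qed.

Lemma const_mulmx_neq0 (p q r : bool) : p -> q -> r ->
  (const_mx 1 : 'M[k]_(p, q)) *m (const_mx 1 : 'M[k]_(q, r)) != 0.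
Proof.
case: p q r => [] [] [] // _ _ _; apply/eqP => /matrixP/(_ ord0 ord0).
by rewrite !mxE big_ord1 !mxE mulr1; apply/eqP/oner_neq0.
Qed.

(** Read off from the quasi-coherence of [structX], applied to the section 1: if the weight space at
    [nu] over U_I were 0, a nonzero product over U_J would vanish. *)
Lemma struct_wt_localize u I J mu : val I \subset val J -> struct_wt u J mu ->
  exists nu, [/\ regular I (nu - mu), regular J (mu - nu) & struct_wt u I nu].
Proof.
move=> IJ hJ; pose s : 'rV[k]_(struct_wt u J (mu - 0)) := const_mx 1.
have [nu [t [r1 r2 /= e]]] := qc_surj (structX_qc k u 0) s IJ.
exists nu; split=> //; apply: contraT => nI.
have r3 : regular J (nu - mu).
  case/asboolP: r1 => a [da ha] ea; apply/asboolP; exists a => //; split=> // j jJ.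
  by apply: ha; apply: contra jJ; apply: (subsetP IJ).
have hJ' : struct_wt u J (nu - 0).
  by rewrite subr0; apply: (struct_wt_between hJ r3 r2 hJ).
rewrite -[nu]subr0 in nI; rewrite (row_false nI t) mul0mx in e.
have hJ0 : struct_wt u J (mu - 0) by rewrite subr0.
by have /eqP := @const_mulmx_neq0 true _ _ isT hJ0 hJ'.
Qed.

Lemma struct_wt_torsion u I J mu : val I \subset val J ->
  struct_wt u I mu -> ~~ struct_wt u J mu ->
  exists nu, [/\ regular I (nu - mu), regular J (mu - nu) & ~~ struct_wt u I nu].
Proof.
move=> IJ hI nJ; pose t : 'rV[k]_(struct_wt u I (mu - 0)) := const_mx 1.
have t0 : t *m res (structX_data k u 0) I J mu = 0.
  by rewrite -[mu]subr0 in nJ; apply: (row_false nJ).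
have [nu [r1 r2 /= e]] := qc_inj (structX_qc k u 0) IJ t0.
exists nu; split=> //; apply/negP => hn.
have hI0 : struct_wt u I (mu - 0) by rewrite subr0.
have hn0 : struct_wt u I (nu - 0) by rewrite subr0.
by have /eqP := @const_mulmx_neq0 true _ _ isT hI0 hn0.
Qed.

Lemma regular_sub I J mu : val I \subset val J -> regular I mu -> regular J mu.
Proof.
move=> IJ /asboolP[a [da ha] ea]; apply/asboolP; exists a => //; split=> // j jJ.
by apply: ha; apply: contra jJ; apply: (subsetP IJ).
Qed.

Lemma tw_localize u d lam I J mu : val I \subset val J -> tw_supp u d lam J mu ->
  exists nu, [/\ regular I (nu - mu), regular J (mu - nu),
                 tw_supp u d lam I nu & tw_supp u d lam J nu].
Proof.
move=> IJ hJ; have [i iI] := chart_pt I; have iJ := subsetP IJ _ iI.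
have := hJ; rewrite (tw_suppE _ _ _ _ iJ) => hJ'.
have [nu [r1 r2 hn]] := struct_wt_localize IJ hJ'.
(* The weight looked for is [nu] shifted back by that of the generator x_i^d. *)
rewrite -[nu](addrK (lam - eps n i.+1 *~ d)) shiftB in r1.
rewrite -[nu](addrK (lam - eps n i.+1 *~ d)) shiftB in r2.
eexists; split; [exact: r1|exact: r2|by rewrite (tw_suppE _ _ _ _ iI) addrK|].
exact: (tw_between (regular_sub IJ r1) r2 hJ hJ).
Qed.

Lemma tw_torsion u d lam I J mu : val I \subset val J ->
  tw_supp u d lam I mu -> ~~ tw_supp u d lam J mu ->
  exists nu, [/\ regular I (nu - mu), regular J (mu - nu) & ~~ tw_supp u d lam I nu].
Proof.
move=> IJ; have [i iI] := chart_pt I; have iJ := subsetP IJ _ iI.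
rewrite (tw_suppE _ _ _ _ iI) (tw_suppE _ _ _ _ iJ) => hI nJ.
have [nu [r1 r2 hn]] := struct_wt_torsion IJ hI nJ.
rewrite -[nu](addrK (lam - eps n i.+1 *~ d)) shiftB in r1.
rewrite -[nu](addrK (lam - eps n i.+1 *~ d)) shiftB in r2.
by eexists; split; [exact: r1|exact: r2|rewrite (tw_suppE _ _ _ _ iI) addrK].
Qed.

Lemma tw_qc u d lam : quasi_coherent (cell_data (tw_supp u d lam)).
Proof.
split=> /= [I J mu s IJ|I J mu t IJ t0].
- have /orP[hJ|nJ] := orbN (tw_supp u d lam J mu); last first.
    exists mu, 0; rewrite subrr; split; try exact: regular0.
    by rewrite (row_false nJ s) !mul0mx.
  have [nu [r1 r2 hnI hnJ]] := tw_localize IJ hJ.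
  by exists nu, (s *m const_mx 1); split=> //; rewrite -mulmxA const_mulmx.
- have /orP[hI|nI] := orbN (tw_supp u d lam I mu); last first.
    exists mu; rewrite subrr; split; try exact: regular0.
    by rewrite [t](row_false nI) mul0mx.
  have /orP[hJ|nJ] := orbN (tw_supp u d lam J mu); last first.
    have [nu [r1 r2 hn]] := tw_torsion IJ hI nJ.
    by exists nu; split=> //; apply: row_false.
  exists mu; rewrite subrr; split; try exact: regular0.
  rewrite -(@const_mulmx _ _ (tw_supp u d lam J mu)) // mulmxA t0 mul0mx //.
Qed.

Lemma row_const (b : bool) (s : 'rV[k]_b) :
  s = (\sum_j s ord0 j) *: (const_mx 1 : 'M_(true, b)).
Proof.
by case: b s => s; apply/rowP=> j; [rewrite !mxE big_ord1 mulr1 !ord1|case: j].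
Qed.

Lemma tw_fg u d lam : finitely_generated (cell_data (tw_supp u d lam)).
Proof.
(* [c] is the weight of x_i^d in the twist by [lam]; this monomial generates over U_I, unless the
   module is 0 there. *)
move=> I; have [i iI] := chart_pt I; pose c := lam - eps n i.+1 *~ d.
exists 1%N, (fun=> c), (fun=> const_mx 1) => mu s.
have hE mu' : tw_supp u d lam I mu' = struct_wt u I (mu' - c).
  exact: tw_suppE.
exists (fun=> \sum_j s ord0 j).
have /orP[h|h] := orbN (tw_supp u d lam I mu); last first.
  by rewrite [LHS](row_false h) [RHS](row_false h).
have hc : tw_supp u d lam I c by rewrite hE subrr (@struct_wt0 _ _ _ (mu - c)) -?hE.
rewrite big_mkcond big_ord1 (@struct_wt_regular _ u) -?hE //=.
by rewrite [_ *m _](@const_mulmx _ true _ _ (fun _ _ => hc)) -row_const.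
Qed.

Definition twist u d lam : coh_sheaf k n :=
  CohSheaf (tw_presheaf u d lam) (tw_qc u d lam) (tw_fg u d lam).

(** By proof irrelevance. It makes [structX] and the twist with d = 0 equal as sheaves, so their
    classes coincide at once. *)
Lemma coh_data_inj (F G : coh_sheaf k n) : coh_data F = coh_data G -> F = G.
Proof.
case: F G => [F f1 f2 f3] [G g1 g2 g3] /= e; case: G / e g1 g2 g3 => g1 g2 g3.
by rewrite (Prop_irrelevance f1 g1) (Prop_irrelevance f2 g2) (Prop_irrelevance f3 g3).
Qed.

Lemma structX_twist u lam : structX k u lam = twist u 0 lam.
Proof.
apply: coh_data_inj => /=; rewrite -[LHS]/(cell_data _).
by congr cell_data; apply/funext => I; apply/funext => mu; rewrite struct_wtE.
Qed.

End Cells.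

(** * The Koszul exact sequences *)

Section Exact.
Variables (k : fieldType) (n : nat).
Local Notation weight := (weight n).
Local Notation chart := (chart n).
Implicit Types (I J K : chart) (S : chart -> weight -> bool) (d : int).
Implicit Types (a : 'rV[int]_n.+1) (lam : weight).

(** The condition for the matrices with all entries 1 to commute with multiplications and
    restrictions: both routes through a square avoid a zero space together. *)
Definition compatible S S' : Prop :=
  (forall I mu nu, regular I (nu - mu) -> S I mu -> S' I nu ->
     S I nu /\ S' I mu) /\
  (forall I J mu, val I \subset val J -> S I mu -> S' J mu ->
     S J mu /\ S' I mu).

Section Hom.
Variables (u u' : nat) (d d' : int) (lam lam' : weight).
Hypothesis compat : compatible (tw_supp u d lam) (tw_supp u' d' lam').

Fact tw_hom_act I mu nu : regular I (nu - mu) ->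
  act (twist k u d lam) I mu nu *m
    (const_mx 1 : 'M_(tw_supp u d lam I nu, tw_supp u' d' lam' I nu)) =
  (const_mx 1 : 'M_(tw_supp u d lam I mu, tw_supp u' d' lam' I mu)) *m
    act (twist k u' d' lam') I mu nu.
Proof.
by move=> r /=; rewrite !const_mulmx // => h1 h2; case: (compat.1 I mu nu r h1 h2).
Qed.

Fact tw_hom_res I J mu : val I \subset val J ->
  res (twist k u d lam) I J mu *m
    (const_mx 1 : 'M_(tw_supp u d lam J mu, tw_supp u' d' lam' J mu)) =
  (const_mx 1 : 'M_(tw_supp u d lam I mu, tw_supp u' d' lam' I mu)) *m
    res (twist k u' d' lam') I J mu.
Proof.
by move=> IJ /=; rewrite !const_mulmx // => h1 h2; case: (compat.2 I J mu IJ h1 h2).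
Qed.

Definition tw_hom : Defs.hom (twist k u d lam) (twist k u' d' lam') :=
  @Defs.Hom _ _ (twist k u d lam) (twist k u' d' lam') (fun I mu => const_mx 1)
    tw_hom_act tw_hom_res.

End Hom.

(** In dimension at most 1, exactness means that the middle space is nonzero exactly when one of the
    outer ones is, and that these are never both nonzero. *)
Lemma const_exact (p q r : bool) : q = p || r -> ~~ (p && r) ->
  [/\ row_free (const_mx 1 : 'M[k]_(p, q)), row_full (const_mx 1 : 'M[k]_(q, r))
    & ((const_mx 1 : 'M[k]_(p, q)) :=: kermx (const_mx 1 : 'M[k]_(q, r)))%MS].
Proof.
have c1 : (const_mx 1 : 'M[k]_(1, 1)) = 1%:M := const_mx_id k true.
move=> -> {q}; case: p r => [] [] //= _; split; try apply/eqmxP;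
  rewrite ?c1 /row_free /row_full ?mxrank1 ?flatmx0 ?thinmx0 ?mxrank0 //.
- by rewrite !kermx0 submx_refl.
- by rewrite (eqP (_ : kermx _ == 0)) ?sub0mx // kermx_eq0 /row_free mxrank1.
- by rewrite submx_refl.
Qed.

(* [x^a] is divisible by x_(o+1) over U_I; indices in ['I_n.+1] start at 0. *)
Definition divides_mon I (o : 'I_n.+1) (a : 'rV[int]_n.+1) :=
  (o \in val I) || (1 <= a ord0 o).

(** Together with [mon_okS], this splits the monomials of the middle sheaf into the multiples of
    x_(o+1), which form the image, and the others, which form a basis of the quotient. *)
Lemma mon_ok_sub I (o : 'I_n.+1) a :
  mon_ok o I (a + unit_row o *~ (- 1)) = mon_ok o I a && divides_mon I o a.
Proof.
have oE : (a + unit_row o *~ (-1)) ord0 o = a ord0 o - 1.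
  by rewrite mxE unit_rowMz eqxx mul1r.
have jE j : j != o -> (a + unit_row o *~ (-1)) ord0 j = a ord0 j.
  by move=> jo; rewrite mxE unit_rowMz (negbTE jo) mul0r addr0.
apply/mon_okP/andP => [h|[/mon_okP h ho] j].
  split.
    apply/mon_okP => j; have [-> |jo] := eqVneq j o.
      have [h1 _] := h o; rewrite oE in h1; split=> [/h1|]; [lia|by rewrite ltnn].
    by rewrite -jE.
  rewrite /divides_mon; case: (boolP (o \in _)) => //= oI.
  by have [/(_ oI)] := h o; rewrite oE; lia.
have [-> |jo] := eqVneq j o; last by rewrite jE.
rewrite oE ltnn; split=> // oI; move: ho; rewrite /divides_mon (negbTE oI) /=.
by lia.
Qed.

Lemma mon_okS I (o : 'I_n.+1) a :
  mon_ok o.+1 I a = mon_ok o I a && ~~ divides_mon I o a.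
Proof.
apply/mon_okP/andP => [h|[/mon_okP h ho] j].
  split.
    by apply/mon_okP => j; have [h1 h2] := h j; split=> // ju; apply: h2; lia.
  by have [_ /(_ (ltnSn o))[]] := h o; rewrite /divides_mon => /negbTE-> ->.
have [h1 h2] := h j; split=> //; rewrite ltnS leq_eqVlt => /orP[/eqP/val_inj e|//].
move: ho; rewrite /divides_mon negb_or -e => /andP[jI]; split=> //.
by have := h1 jI; lia.
Qed.

Section Koszul.
Variables (o : 'I_n.+1) (d : int) (lam : weight).
Local Notation SA := (tw_supp o (d - 1) (lam - eps n o.+1)).
Local Notation SB := (tw_supp o d lam).
Local Notation SC := (tw_supp o.+1 d lam).

Lemma suppE u a I : deg a = d -> tw_supp u d lam I (lam - wt a) = mon_ok u I a.
Proof. by move=> da; rewrite /tw_supp addrAC subrr add0r tw_wtE. Qed.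

(** All three supports are indexed by exponents of degree [d]: x_(o+1) has weight -eps_(o+1), and
    the twist of the first sheaf makes multiplication by it preserve weights. *)
Lemma suppAE a I : deg a = d ->
  SA I (lam - wt a) = mon_ok o I a && divides_mon I o a.
Proof.
move=> da; rewrite -mon_ok_sub -(@tw_wtE _ o (d - 1) I); last first.
  by rewrite degD deg_unitMz da.
rewrite /tw_supp wtD wtMz wt_unit_row mulrN1z.
by rewrite opprB [lam - _ + _]addrC addrA subrK opprB.
Qed.

Lemma supp_elim u I mu : tw_supp u d lam I mu ->
  exists2 a, deg a = d & mu = lam - wt a.
Proof. by case/asboolP=> a [da _] e; exists a => //; rewrite -e addrC subrK. Qed.

Lemma suppA_elim I mu : SA I mu -> exists2 a, deg a = d & mu = lam - wt a.
Proof.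
case/asboolP=> a [da _] e; exists (a + unit_row o *~ 1).
  by rewrite degD deg_unitMz da subrK.
by rewrite wtD wtMz wt_unit_row mulr1z opprD addrA addrAC -e [RHS]addrC subrK.
Qed.

Lemma divides_mono I a c : mon_ok 0 I (c - a) -> divides_mon I o a ->
  divides_mon I o c.
Proof.
rewrite /divides_mon => /mon_okP/(_ o)[h _]; case: (boolP (o \in _)) => //= oI.
by have := h oI; rewrite !mxE subr_ge0 => h1 h2; apply: le_trans h2 h1.
Qed.

Lemma regular_wtE I a c : deg a = d -> deg c = d ->
  regular I (lam - wt c - (lam - wt a)) = mon_ok 0 I (c - a).
Proof.
move=> da dc; rewrite regularE opprB addrC addrA subrK -opprB -wtN -wtD.
by apply: tw_wtE; rewrite degD degN da dc subrr.
Qed.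

(** Divisibility by x_(o+1) persists under multiplication and restriction. *)
Lemma koszul_compatl : compatible SA SB.
Proof.
split=> [I mu nu r|I J mu IJ] hA hB; have [a da ea] := suppA_elim hA.
  have [c dc ec] := supp_elim hB; move: r hA hB; subst mu nu.
  rewrite regular_wtE // !suppAE // !suppE // => r /andP[-> ha] ->; split=> //.
  exact: divides_mono ha.
move: hA hB; subst mu; rewrite !suppAE // !suppE // => /andP[-> ha] ->; split=> //.
by move: ha; rewrite /divides_mon => /orP[/(subsetP IJ)->|->] //; rewrite orbT.
Qed.
Lemma koszul_compatr : compatible SB SC.
Proof.
split=> [I mu nu r|I J mu IJ] hB hC; have [a da ea] := supp_elim hB.
  have [c dc ec] := supp_elim hC; move: r hB hC; subst mu nu.
  rewrite regular_wtE // !suppE // !mon_okS => r -> /andP[-> hc]; split=> //.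
  by apply: contra hc; apply: divides_mono.
move: hB hC; subst mu; rewrite !suppE // !mon_okS => -> /andP[-> ha]; split=> //.
by move: ha; rewrite /divides_mon !negb_or => /andP[/(contra (subsetP IJ o))-> ->].
Qed.

Lemma koszul_exact :
  short_exact (tw_hom koszul_compatl) (tw_hom koszul_compatr).
Proof.
move=> I mu; apply: const_exact.
  apply/idP/orP => [hB|[hA|hC]].
  - have [a da e] := supp_elim hB; move: hB; rewrite e suppAE // !suppE // mon_okS.
    by move=> ->; case: divides_mon; [left|right].
  - have [a da e] := suppA_elim hA; move: hA; rewrite e suppAE // suppE //.
    by case/andP.
  - have [a da e] := supp_elim hC; move: hC; rewrite e !suppE // mon_okS.
    by case/andP.
apply/negP => /andP[hA hC]; have [a da e] := suppA_elim hA; move: hA hC.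
by rewrite e suppAE // suppE // mon_okS => /andP[_ ->] /andP[].
Qed.
End Koszul.

Lemma tw_supp_empty d lam I mu : tw_supp n.+1 d lam I mu = false.
Proof.
apply/negP => /asboolP[a [_ /mon_okP h] _]; have [i iI] := chart_pt I.
by have [_ /(_ (ltn_ord i))[]] := h i; rewrite iI.
Qed.

Lemma cls_short_exact (F G H : coh_sheaf k n) (f : Defs.hom F G) (g : Defs.hom G H) :
  short_exact f g -> cls G = cls F + cls H.
Proof.
move=> ex; apply/eqP; rewrite -subr_eq0 opprD addrA; apply/eqP.
rewrite /cls -!raddfB -[RHS](raddf0 (\pi_(KT k n))%qT).
apply/eqP; rewrite -Quotient.idealrBE subr0; apply/asboolP.
exact: ses_span_exact ex.
Qed.

Lemma cls_koszul (o : 'I_n.+1) d lam :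
  cls (twist k o.+1 d lam) =
  cls (twist k o d lam) - cls (twist k o (d - 1) (lam - eps n o.+1)).
Proof. by rewrite (cls_short_exact (koszul_exact o d lam)) addrC addKr. Qed.

(** All weight spaces being 0, the sheaf Z fits into 0 -> Z -> Z -> Z -> 0, so its class equals its
    double. *)
Lemma cls_empty d lam : cls (twist k n.+1 d lam) = 0.
Proof.
have c : compatible (tw_supp n.+1 d lam) (tw_supp n.+1 d lam).
  by split=> [I mu nu _|I J mu _]; rewrite tw_supp_empty.
have ex : short_exact (tw_hom c) (tw_hom c).
  by move=> I mu; apply: const_exact; rewrite tw_supp_empty.
by have /eqP := cls_short_exact ex; rewrite -subr_eq0 opprD addNKr oppr_eq0 => /eqP.
Qed.

End Exact.

(** * Tensor products of line bundles *)

Section Tensor.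
Variables (k : fieldType) (n : nat).
Local Notation weight := (weight n).
Local Notation chart := (chart n).
Implicit Types (I J K : chart) (d : int) (lam mu nu rho : weight).

Lemma regularD I mu nu : regular I mu -> regular I nu -> regular I (mu + nu).
Proof.
case/asboolP=> a ma -> /asboolP[b mb ->]; apply/asboolP; exists (a + b).
  exact: monomial_onD.
by rewrite wtD opprD.
Qed.

Lemma tw_supp0E d lam I i mu : i \in val I ->
  tw_supp 0 d lam I mu = regular I (mu - (lam - eps n i.+1 *~ d)).
Proof. by move=> iI; rewrite (tw_suppE _ _ _ _ iI) struct_wtE regularE. Qed.

Lemma tw_supp0_regular d lam I mu nu : regular I (nu - mu) ->
  tw_supp 0 d lam I mu -> tw_supp 0 d lam I nu.
Proof.
have [i iI] := chart_pt I; rewrite !(tw_supp0E _ _ _ iI) => r1 r2.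
by have := regularD r1 r2; rewrite addrA subrK.
Qed.

Lemma tw_supp0_res d lam I J mu : val I \subset val J ->
  tw_supp 0 d lam I mu -> tw_supp 0 d lam J mu.
Proof.
move=> IJ; have [i iI] := chart_pt I; rewrite (tw_supp0E _ _ _ iI).
by rewrite (tw_supp0E _ _ _ (subsetP IJ _ iI)); apply: regular_sub.
Qed.

Lemma mx_false (b : bool) m (A B : 'M[k]_(b, m)) : ~~ b -> A = B.
Proof. by case: b A B => // A B _; rewrite [A]flatmx0 [B]flatmx0. Qed.

(** Over U_I the module is free on x_i^d, so this generator and its coordinate form suffice. *)
Lemma twist_vector_bundle d lam : vector_bundle (twist k 0 d lam).
Proof.
move=> I; have [i iI] := chart_pt I; pose c := lam - eps n i.+1 *~ d.
have hE mu := tw_supp0E d lam mu iI.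
exists 1%N, (fun=> c), (fun=> const_mx 1), (fun _ mu => const_mx 1); split=> /=.
- by move=> _ mu nr; apply: mx_false; rewrite hE.
- move=> _ mu nu r; apply: (@const_mulmx k _ _ true) => h _.
  exact: tw_supp0_regular r h.
- move=> mu; rewrite big_ord1 (@const_mulmx k true) => [|_ _]; last first.
    by rewrite hE subrr regular0.
  by rewrite (@const_mulmx k _ true) // const_mx_id.
Qed.

(** On a weight space of dimension at most 1 this is the only coordinate; written as a sum, it is
    also defined, with value 0, on the zero space. *)
Definition coord m (s : 'rV[k]_m) : k := \sum_j s ord0 j.

Lemma coord_linear m a (s t : 'rV[k]_m) :
  coord (a *: s + t) = a * coord s + coord t.
Proof.
by rewrite /coord mulr_sumr -big_split; apply: eq_bigr => j _; rewrite !mxE.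
Qed.

Lemma coord_neq0 (b : bool) (s : 'rV[k]_b) : coord s != 0 -> b.
Proof. by case: b s => // s; rewrite /coord big_ord0 eqxx. Qed.

Lemma coord_mul (p q : bool) (s : 'rV[k]_p) : (p -> q) ->
  coord (s *m (const_mx 1 : 'M_(p, q))) = coord s.
Proof.
case: p q s => [] [] s h; rewrite /coord ?big_ord1 ?big_ord0 //.
- by rewrite !mxE big_ord1 mxE mulr1.
- by have := h isT.
- by rewrite mxE big_ord0.
Qed.

Section TensorOfTwists.
Variables (d d' : int) (lam lam' : weight).
Local Notation E := (twist k 0 d lam).
Local Notation F := (twist k 0 d' lam').
Local Notation P := (twist k 0 (d + d') (lam + lam')).
Local Notation SE := (tw_supp 0 d lam).
Local Notation SF := (tw_supp 0 d' lam').
Local Notation SP := (tw_supp 0 (d + d') (lam + lam')).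

Lemma twist_gen_add (i : 'I_n.+1) :
  lam + lam' - eps n i.+1 *~ (d + d') =
  lam - eps n i.+1 *~ d + (lam' - eps n i.+1 *~ d').
Proof. by rewrite mulrzDr opprD addrACA. Qed.

Lemma supp_add I mu nu : SE I mu -> SF I nu -> SP I (mu + nu).
Proof.
have [i iI] := chart_pt I; rewrite !(tw_supp0E _ _ _ iI) twist_gen_add => h1 h2.
by rewrite opprD addrACA regularD.
Qed.

Definition twist_mul I mu nu (s : 'rV[k]_(SE I mu)) (t : 'rV[k]_(SF I nu)) :
    'rV[k]_(SP I (mu + nu)) :=
  (coord s * coord t) *: (const_mx 1 : 'M_(true, SP I (mu + nu))).

(** The common form of all compatibilities of the pairing. If both coordinates are nonzero then so
    are both weight spaces, hence also the one containing the product. *)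
Lemma twist_mul_const I mu nu J rho (s : 'rV[k]_(SE I mu)) (t : 'rV[k]_(SF I nu)) :
  twist_mul s t *m (const_mx 1 : 'M_(SP I (mu + nu), SP J rho)) =
  (coord s * coord t) *: (const_mx 1 : 'M_(true, SP J rho)).
Proof.
rewrite /twist_mul -scalemxAl.
have [->|/coord_neq0 hs] := eqVneq (coord s) 0; first by rewrite mul0r !scale0r.
have [->|/coord_neq0 ht] := eqVneq (coord t) 0; first by rewrite mulr0 !scale0r.
by rewrite (@const_mulmx k true) // => _ _; apply: supp_add.
Qed.

Fact twist_mul_linl I mu nu (t : 'rV[k]_(SF I nu)) :
  linear (fun s : 'rV[k]_(SE I mu) => twist_mul s t).
Proof.
by move=> a s s'; rewrite /twist_mul coord_linear mulrDl -mulrA scalerDl scalerA.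
Qed.

Fact twist_mul_linr I mu nu (s : 'rV[k]_(SE I mu)) :
  linear (fun t : 'rV[k]_(SF I nu) => twist_mul s t).
Proof.
by move=> a t t'; rewrite /twist_mul coord_linear mulrDr mulrCA scalerDl scalerA.
Qed.

Fact twist_mul_actl I mu mu' nu (s : 'rV[k]_(SE I mu)) (t : 'rV[k]_(SF I nu)) :
  regular I (mu' - mu) ->
  twist_mul (s *m act E I mu mu') t = twist_mul s t *m act P I (mu + nu) (mu' + nu).
Proof.
move=> r; rewrite [RHS]twist_mul_const {1}/twist_mul coord_mul //.
exact: tw_supp0_regular.
Qed.

Fact twist_mul_actr I mu nu nu' (s : 'rV[k]_(SE I mu)) (t : 'rV[k]_(SF I nu)) :
  regular I (nu' - nu) ->
  twist_mul s (t *m act F I nu nu') = twist_mul s t *m act P I (mu + nu) (mu + nu').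
Proof.
move=> r; rewrite [RHS]twist_mul_const {1}/twist_mul coord_mul //.
exact: tw_supp0_regular.
Qed.

Fact twist_mul_res I J mu nu (s : 'rV[k]_(SE I mu)) (t : 'rV[k]_(SF I nu)) :
  val I \subset val J ->
  twist_mul (s *m res E I J mu) (t *m res F I J nu) =
  twist_mul s t *m res P I J (mu + nu).
Proof.
move=> IJ; rewrite [RHS]twist_mul_const {1}/twist_mul !coord_mul //;
  exact: tw_supp0_res.
Qed.

Definition twist_pairing : pairing E F P :=
  @Pairing k n E F P twist_mul twist_mul_linl twist_mul_linr
    twist_mul_actl twist_mul_actr twist_mul_res.

Section Universal.
Variables (Q : coh_sheaf k n) (c : pairing E F Q).

Definition pair1 I mu nu : 'rV[k]_(sec Q I (mu + nu)) :=
  c I mu nu (const_mx 1 : 'M_(true, SE I mu)) (const_mx 1 : 'M_(true, SF I nu)).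

Lemma linear_scale (U V : lmodType k) (f : U -> V) a x :
  linear f -> f (a *: x) = a *: f x.
Proof.
move=> lf; have f0 : f 0 = 0.
  by apply: (@addIr _ (f 0)); rewrite add0r -{1}[f 0]scale1r -lf scale1r addr0.
by rewrite -[a *: x]addr0 lf f0 addr0.
Qed.

Lemma pairE I mu nu (s : 'rV[k]_(SE I mu)) (t : 'rV[k]_(SF I nu)) :
  c I mu nu s t = (coord s * coord t) *: pair1 I mu nu.
Proof.
rewrite [s in LHS]row_const [t in LHS]row_const -scalerA.
rewrite (linear_scale _ _ (pair_linl c _)) (linear_scale _ _ (pair_linr c _)) //.
Qed.

(** The weight of the generator x_i^d over U_I. The same i is chosen for both bundles, so that the
    product of the generators generates the tensor product. *)
Definition genE I := lam - eps n (xchoose (chart_pt I)).+1 *~ d.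
Definition genF I := lam' - eps n (xchoose (chart_pt I)).+1 *~ d'.

Let SEE I mu : SE I mu = regular I (mu - genE I).
Proof. exact: tw_supp0E (xchooseP _). Qed.

Let SFE I mu : SF I mu = regular I (mu - genF I).
Proof. exact: tw_supp0E (xchooseP _). Qed.

Let SPE I mu : SP I mu = regular I (mu - (genE I + genF I)).
Proof. by rewrite (tw_supp0E _ _ _ (xchooseP (chart_pt I))) twist_gen_add. Qed.

(** Both monomials are multiples of the generators, so a pairing is determined by its value on
    these. *)
Lemma pair1_gen I mu nu rho : SE I mu -> SF I nu ->
  regular I (rho - (mu + nu)) ->
  pair1 I mu nu *m act Q I (mu + nu) rho =
  pair1 I (genE I) (genF I) *m act Q I (genE I + genF I) rho.
Proof.
move=> hE hF r; have gE : SE I (genE I) by rewrite SEE subrr regular0.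
have gF : SF I (genF I) by rewrite SFE subrr regular0.
have rE : regular I (mu - genE I) by rewrite -SEE.
have rF : regular I (nu - genF I) by rewrite -SFE.
have rE' : regular I (mu + genF I - (genE I + genF I)).
  by rewrite opprD addrACA subrr addr0.
have rF' : regular I (mu + nu - (mu + genF I)) by rewrite opprD addrACA subrr add0r.
have eE : (const_mx 1 : 'M_(true, SE I mu)) =
    (const_mx 1 : 'M[k]_(true, SE I (genE I))) *m act E I (genE I) mu.
  by rewrite (@const_mulmx k true).
have eF : (const_mx 1 : 'M_(true, SF I nu)) =
    (const_mx 1 : 'M[k]_(true, SF I (genF I))) *m act F I (genF I) nu.
  by rewrite (@const_mulmx k true).
rewrite {1}/pair1 eE eF (pair_actr c) // (pair_actl c) // -/(pair1 _ _ _).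
have ac := act_comp (coh_presheaf Q).
have rEF' : regular I (rho - (mu + genF I)).
  by have := regularD r rF'; rewrite addrA subrK.
by rewrite -!mulmxA !ac.
Qed.

Definition tensor_fun I mu : 'M[k]_(SP I mu, sec Q I mu) :=
  (const_mx 1 : 'M_(SP I mu, true)) *m
    (pair1 I (genE I) (genF I) *m act Q I (genE I + genF I) mu).

Fact tensor_fun_act I mu nu : regular I (nu - mu) ->
  act P I mu nu *m tensor_fun I nu = tensor_fun I mu *m act Q I mu nu.
Proof.
move=> r; have /orP[h|h] := orbN (SP I mu); last exact: mx_false.
rewrite mulmxA (@const_mulmx k _ _ true); last first.
  by move=> _ _; apply: tw_supp0_regular r h.
by rewrite -!mulmxA (act_comp (coh_presheaf Q)) // -SPE.
Qed.

Fact tensor_fun_res I J mu : val I \subset val J ->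
  res P I J mu *m tensor_fun J mu = tensor_fun I mu *m res Q I J mu.
Proof.
move=> IJ; have /orP[h|h] := orbN (SP I mu); last exact: mx_false.
have r : regular I (mu - (genE I + genF I)) by rewrite -SPE.
have gE : SE I (genE I) by rewrite SEE subrr regular0.
have gF : SF I (genF I) by rewrite SFE subrr regular0.
rewrite mulmxA (@const_mulmx k _ _ true); last by move=> _ _; apply: tw_supp0_res IJ h.
rewrite -!mulmxA (act_res (coh_presheaf Q)) //; congr (_ *m _); rewrite mulmxA.
rewrite -(pair_res c) // [_ *m res E _ _ _](@const_mulmx k true) //.
rewrite [_ *m res F _ _ _](@const_mulmx k true) //; symmetry.
(* The generators restricted from I need not be those chosen over J; [pair1_gen] over J compares the
   two. *)
apply: pair1_gen; last exact: regular_sub r.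
  exact: tw_supp0_res gE.
exact: tw_supp0_res gF.
Qed.

Definition tensor_hom : Defs.hom P Q :=
  @Defs.Hom _ _ P Q tensor_fun tensor_fun_act tensor_fun_res.

Lemma tensor_homE I mu nu s t :
  c I mu nu s t = twist_pairing I mu nu s t *m tensor_hom I (mu + nu).
Proof.
rewrite pairE /= /twist_mul -scalemxAl.
have [->|/coord_neq0 hs] := eqVneq (coord s) 0; first by rewrite mul0r !scale0r.
have [->|/coord_neq0 ht] := eqVneq (coord t) 0; first by rewrite mulr0 !scale0r.
congr (_ *: _); rewrite /tensor_fun mulmxA (@const_mulmx k true _ true); last first.
  by move=> _ _; apply: supp_add.
rewrite -(pair1_gen hs ht) // ?subrr ?regular0 // (act_id (coh_presheaf Q)) mulmx1.
by rewrite (const_mx_id k true) mul1mx.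
Qed.

Lemma tensor_hom_uniq (f : Defs.hom P Q) :
  (forall I mu nu s t, c I mu nu s t = twist_pairing I mu nu s t *m f I (mu + nu)) ->
  forall I mu, f I mu = tensor_hom I mu.
Proof.
move=> fE I mu; have /orP[h|h] := orbN (SP I mu); last exact: mx_false.
have gF : SF I (genF I) by rewrite SFE subrr regular0.
(* Every nonzero weight space of the product is spanned by a monomial times the generator of the
   second bundle, so a morphism is determined by the pairing. *)
have e : mu = (mu - genF I) + genF I by rewrite subrK.
have gE : SE I (mu - genF I) by rewrite SEE -addrA -opprD [genF I + _]addrC -SPE.
move: (mu - genF I) e gE => mu1 e gE; subst mu.
have c1 (b : bool) : b -> coord (const_mx 1 : 'M[k]_(true, b)) = 1.
  by case: b => // _; rewrite /coord big_ord1 mxE.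
have := fE I mu1 (genF I) (const_mx 1 : 'M_(true, _)) (const_mx 1 : 'M_(true, _)).
rewrite tensor_homE /= /twist_mul !c1 // mulr1 !scale1r => e.
have inj : (const_mx 1 : 'M[k]_(SP I (mu1 + genF I), true)) *m
    (const_mx 1 : 'M_(true, SP I (mu1 + genF I))) = 1%:M.
  by rewrite (@const_mulmx k _ true) // const_mx_id.
by rewrite -[LHS]mul1mx -[RHS]mul1mx -inj -!mulmxA; congr (_ *m _).
Qed.

End Universal.

Lemma twist_tensor : is_tensor E F P.
Proof.
exists twist_pairing => Q c; exists (tensor_hom c); split.
  exact: tensor_homE.
exact: tensor_hom_uniq.
Qed.

End TensorOfTwists.
End Tensor.

(** * Dimensions of weight spaces *)

Section Rank.
Variables (k : fieldType) (n : nat).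
Local Notation weight := (weight n).
Local Notation chart := (chart n).
Implicit Types (I : chart) (mu lam : weight) (x y : free_group k n).

Definition dim_fun I mu (F : {classic coh_sheaf k n}) : int :=
  (sec (F : coh_sheaf k n) I mu)%:Z.

Lemma dim_short_exact (F G H : coh_sheaf k n) (f : Defs.hom F G) (g : Defs.hom G H)
    I mu : short_exact f g -> sec G I mu = (sec F I mu + sec H I mu)%N.
Proof.
move=> /(_ I mu)[/eqP fF /eqP gH e]; have := mxrank_ker (g I mu).
by rewrite -e fF gH => ->; rewrite subnK // -[X in (X <= _)%N]gH rank_leq_row.
Qed.

Lemma dim_ses_span I mu x : ses_span x -> lift (dim_fun I mu) x = 0.
Proof.
elim=> [|y z _ hy _ hz|F G H f g ex]; first exact: raddf0.
  by rewrite raddfB /= hy hz subrr.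
rewrite !raddfB /= !liftU /dim_fun (dim_short_exact I mu ex) PoszD; lia.
Qed.

(** Computed on an arbitrary representative; [dim_pi] gives independence of it, as rank-nullity
    makes dimensions additive on short exact sequences. *)
Definition dim I mu (z : KT k n) : int := lift (dim_fun I mu) (repr z).

Lemma dim_pi I mu x : dim I mu (\pi_(KT k n) x)%qT = lift (dim_fun I mu) x.
Proof.
apply/eqP; rewrite -subr_eq0 -raddfB; apply/eqP/dim_ses_span/asboolP.
by have /eqP := reprK (\pi_(KT k n) x)%qT; rewrite -Quotient.idealrBE.
Qed.

Fact dim_is_additive I mu : zmod_morphism (dim I mu).
Proof.
move=> z t; rewrite -[z]reprK -[t]reprK -raddfB !dim_pi raddfB //.
Qed.

HB.instance Definition _ I mu :=
  GRing.isZmodMorphism.Build (KT k n) int (dim I mu) (dim_is_additive I mu).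

Lemma dim_twist I mu u d lam : dim I mu (cls (twist k u d lam)) = tw_supp u d lam I mu.
Proof. by rewrite dim_pi liftU mulr1z. Qed.

End Rank.

(** * Convolution with a pointed cone of weights *)

Section Convolution.
Variable n : nat.
Local Notation weight := (weight n).
Implicit Types (a b : 'rV[int]_n.+1) (lam mu : weight) (w : 'I_n.+1).

Fact set1_chart w : [set w]%SET != finset.set0.
Proof. by apply/finset.set0Pn; exists w; rewrite finset.in_set1. Qed.

Definition point_chart w : chart n :=
  exist (fun I : {set 'I_n.+1} => I != finset.set0) [set w]%SET (set1_chart w).

(* A linear functional, negative on the weights of the nonconstant monomials that
   are regular at the fixed point [w]. *)
Definition height w lam : int := deg (repr lam) - (repr lam) ord0 w *+ n.+1.

(** Adding (1,...,1) raises both terms by n + 1, so the height does not depend on the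
    representative. *)
Lemma height_wt w a : height w (wt a) = deg a - a ord0 w *+ n.+1.
Proof.
have /eqP : wt (repr (wt a)) = wt a by rewrite /wt reprK.
rewrite /wt -Quotient.idealrBE /height => /forallP h; set b := repr _ in h *.
have hw j : (b - a) ord0 j = (b - a) ord0 w by rewrite (eqP (h j)) (eqP (h w)).
have : deg (b - a) = (b - a) ord0 w *+ n.+1.
  by rewrite /deg (eq_bigr _ (fun j _ => hw j)) sumr_const card_ord.
rewrite degD degN 2!mxE mulrnBl.
by move: (b _ _ *+ _) (a _ _ *+ _) => x y; lia.
Qed.

Lemma exists_maximum (T : eqType) (f : T -> int) (s : seq T) : s != [::] ->
  exists2 x, x \in s & forall y, y \in s -> f y <= f x.
Proof.
elim: s => // x [|y s] IH _.
  by exists x; rewrite ?mem_head // => y; rewrite inE => /eqP->.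
have [z zs hz] := IH isT; case: (leP (f z) (f x)) => h.
  exists x; rewrite ?mem_head // => t; rewrite inE => /orP[/eqP->//|/hz ht].
  exact: le_trans h.
exists z; first by rewrite inE zs orbT.
by move=> t; rewrite inE => /orP[/eqP->|/hz//]; apply: ltW.
Qed.

(** Here lam = mu + wt a, where a_w is minus the sum of the other, nonnegative entries. The height
    of [lam] exceeds that of [mu] by n + 1 times this sum, which must be 0. *)
Lemma tw_wt_height w lam mu : tw_wt w 0 (point_chart w) (mu - lam) ->
  height w lam <= height w mu -> lam = mu.
Proof.
case/asboolP => a [da /mon_okP h] e.
have eb : mu = wt (repr mu) by rewrite /wt reprK.
have el : lam = wt (repr mu + a).
  by rewrite wtD -eb -[wt a]opprK -e opprB addrC subrK.
have a0 j : j != w -> 0 <= a ord0 j.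
  by move=> jw; apply: (h j).1; rewrite finset.in_set1.
have aw : a ord0 w = - \sum_(j | j != w) a ord0 j.
  by apply/eqP; rewrite -addr_eq0; move: da; rewrite /deg (bigD1 w) //= => ->.
have hl : height w lam = height w mu - a ord0 w *+ n.+1.
  by rewrite el {2}eb !height_wt degD da addr0 mxE mulrnDl opprD addrA.
have s0 : 0 <= \sum_(j | j != w) a ord0 j by apply: sumr_ge0.
rewrite hl aw => hle; have s1 : \sum_(j | j != w) a ord0 j = 0 by lia.
suff a00 : a = 0 by rewrite el a00 addr0 /wt reprK.
apply/rowP => j; rewrite mxE; have [->|jw] := eqVneq j w; first by rewrite aw s1 oppr0.
exact: (psumr_eq0P a0 s1 jw).
Qed.

(** Evaluated at a weight of maximal height in the support of [q], the sum keeps only the term of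
    that weight. *)
Lemma convolution_injective w (q : repring n) :
  (forall mu, \sum_(lam <- msupp q)
     (tw_wt w 0 (point_chart w) (mu - lam) : int) *~ q@_lam = 0) -> q = 0.
Proof.
move=> hq; have [e|q0] := eqVneq (msupp q) fset0.
  by rewrite [q]monalgE e big_seq_fset0.
exfalso.
have s0 : (msupp q : seq _) != [::].
  by apply: contra q0 => /eqP e; apply/eqP/fsetP => x;
    rewrite in_fset0 -[x \in _]/(x \in enum_fset (msupp q)) e.
have [lam ls hmax] := exists_maximum (height w) s0.
move: (hq lam); rewrite (big_fsetD1 lam) //= big1_fset => [|l].
  rewrite addr0 subrr.
  have -> : tw_wt w 0 (point_chart w) 0.
    have {1}-> : 0 = - wt 0 :> weight by rewrite /wt raddf0 oppr0.
    rewrite tw_wtE ?deg0 //; apply/mon_okP => j; rewrite mxE; split=> // jw.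
    by split=> //; rewrite finset.in_set1; apply: contraTneq jw => ->; rewrite ltnn.
  by move=> /eqP; rewrite intz => qlam; move: ls; rewrite -mcoeff_neq0 qlam.
rewrite !inE => /andP[ll lq] _.
have [/tw_wt_height h|] := boolP (tw_wt _ _ _ _); last by rewrite mul0rz.
by move: ll; rewrite h ?eqxx // hmax.
Qed.

End Convolution.

(** * Classes as Laurent polynomials *)

(* R(T)[s, s^-1]: the basis element of (lam, d) stands for e^lam s^d, which
   maps to the class of O(d) twisted by lam. *)
Notation laurent n := (group_ring (weight n * int)%type).

Lemma big_prod1_recr (A : comNzRingType) (f : nat -> A) u :
  \prod_(1 <= i < u.+2) f i = f u.+1 * \prod_(1 <= i < u.+1) f i.
Proof. by rewrite big_nat_recr //= mulrC. Qed.

Lemma mulB_factor (A : comNzRingType) (a e p : A) :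
  a * p - a * e * p = a * ((1 - e) * p).
Proof. by ring. Qed.

Section Laurent.
Variable n : nat.
Local Notation weight := (weight n).

Definition lmon (lam : weight) (d : int) : laurent n := gexp (lam, d).

Lemma lmonD lam mu d e : lmon (lam + mu) (d + e) = lmon lam d * lmon mu e.
Proof. exact: (gexpD (lam, d) (mu, e)). Qed.

Lemma lmon0 : lmon 0 0 = 1. Proof. by []. Qed.

Definition const_lau (q : repring n) : laurent n := lift (fun lam => lmon lam 0) q.

Fact const_lau_is_additive : zmod_morphism const_lau.
Proof. exact: lift_is_additive. Qed.

Fact const_lau_is_multiplicative : monoid_morphism const_lau.
Proof.
split=> [|x y]; first exact: lift_gexp.
rewrite /const_lau -(@lift_mul _ _ *%R) //.
- exact: mulrBl.
- exact: mulrBr.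
- by move=> g h; rewrite -lmonD addr0.
Qed.

HB.instance Definition _ :=
  GRing.isZmodMorphism.Build (repring n) (laurent n) const_lau const_lau_is_additive.
HB.instance Definition _ :=
  GRing.isMonoidMorphism.Build (repring n) (laurent n) const_lau
    const_lau_is_multiplicative.

Lemma const_lau_e lam : const_lau (e_ lam) = lmon lam 0.
Proof. exact: lift_gexp. Qed.

End Laurent.

Section KTheory.
Variables (k : fieldType) (n : nat).
Local Notation weight := (weight n).

Definition KT_class (x : laurent n) : KT k n :=
  lift (fun g : weight * int => cls (twist k 0 g.2 g.1)) x.

Fact KT_class_is_additive : zmod_morphism KT_class.
Proof. exact: lift_is_additive. Qed.

HB.instance Definition _ :=
  GRing.isZmodMorphism.Build (laurent n) (KT k n) KT_class KT_class_is_additive.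

Lemma KT_class_lmon lam d : KT_class (lmon lam d) = cls (twist k 0 d lam).
Proof. exact: lift_gexp. Qed.

(** On basis elements this is the tensor product of two line bundles; [lift_mul] extends it. *)
Lemma KT_class_mul (mul : KT k n -> KT k n -> KT k n) x y : KT_product mul ->
  mul (KT_class x) (KT_class y) = KT_class (x * y).
Proof.
case=> addl addr tens; apply: lift_mul => // -[lam d] [mu e] /=.
apply: tens; [exact: twist_vector_bundle|exact: twist_vector_bundle|].
exact: twist_tensor.
Qed.

Lemma from_repring_KT_class (q : repring n) :
  from_repring k q = KT_class (const_lau q).
Proof.
rewrite /const_lau lift_comp; apply: eq_lift => lam /=.
by rewrite KT_class_lmon structX_twist.
Qed.

(** A representative of the class of O_{X^u}: the Koszul sequence for x_i contributes the factor 1 -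
    s^(-1) e^(-eps_i). *)
Definition koszul_prod (u : nat) : laurent n :=
  \prod_(1 <= i < u.+1) (1 - lmon (- eps n i) (-1)).

Lemma koszul_prodS u :
  koszul_prod u.+1 = (1 - lmon (- eps n u.+1) (-1)) * koszul_prod u.
Proof. exact: big_prod1_recr. Qed.

Lemma cls_twist u d lam : (u <= n.+1)%N ->
  cls (twist k u d lam) = KT_class (lmon lam d * koszul_prod u).
Proof.
elim: u d lam => [|u IH] d lam hu.
  by rewrite /koszul_prod big_nil mulr1 KT_class_lmon.
rewrite (cls_koszul _ (Ordinal hu)) /= !IH 1?ltnW // -raddfB; congr KT_class.
by rewrite (koszul_prodS u) (lmonD lam (- eps n u.+1) d (-1)) mulB_factor.
Qed.

Lemma KT_class_koszul0 x : KT_class (x * koszul_prod n.+1) = 0.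
Proof.
rewrite [x]gexpE /lift mulr_suml raddf_sum big1 // => -[lam d] _.
by rewrite mulrzAl raddfMz /= -cls_twist // cls_empty mul0rz.
Qed.

Definition xi_lau u : laurent n := koszul_prod u - koszul_prod u.+1.

Lemma KT_class_xi_lau lam u : (u <= n)%N ->
  KT_class (lmon lam 0 * xi_lau u) =
  cls (twist k u 0 lam) - cls (twist k u.+1 0 lam).
Proof.
move=> un; rewrite (cls_twist _ _ (leqW un)) cls_twist; last exact: un.
by rewrite -raddfB -(mulrBr (lmon lam 0) (koszul_prod u) (koszul_prod u.+1)).
Qed.

Lemma xi_KT_class u : (u <= n)%N -> xi k n u = KT_class (xi_lau u).
Proof.
move=> un; rewrite /xi !structX_twist -KT_class_xi_lau //.
by rewrite (lmon0 n) (mul1r (xi_lau u)).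
Qed.

(** A triangular system: the coefficients below w vanish by induction, the classes above w vanish on
    the chart x_(w+1) <> 0, and injectivity of the convolution settles w itself. *)
Lemma xi_lau_independent (q : nat -> repring n) :
  \sum_(0 <= w < n.+1) KT_class (const_lau (q w) * xi_lau w) = 0 ->
  forall w, (w <= n)%N -> q w = 0.
Proof.
move=> hq w; elim/ltn_ind: w => w IH wn; have wn1 : (w < n.+1)%N by [].
apply: (@convolution_injective _ (Ordinal wn1)) => mu.
set I := point_chart _.
have dimE v : (v <= n)%N -> dim I mu (KT_class (const_lau (q v) * xi_lau v)) =
  \sum_(lam <- msupp (q v))
    ((tw_supp v 0 lam I mu : int) - (tw_supp v.+1 0 lam I mu : int)) *~ (q v)@_lam.
  move=> vn; rewrite /const_lau /lift mulr_suml.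
  rewrite [KT_class _]raddf_sum [dim _ _ _]raddf_sum.
  apply: eq_bigr => lam _; rewrite /= mulrzAl [KT_class _]raddfMz /=.
  rewrite [dim _ _ _]raddfMz /=; congr (_ *~ _).
  by rewrite KT_class_xi_lau // [dim _ _ _]raddfB /= !dim_twist.
(* X^v misses this chart when v > w; in particular xi^w is there the class of O_{X^w} alone. *)
have tw0 v lam : (w < v)%N -> tw_supp v 0 lam I mu = false.
  move=> wv; apply/negP => /asboolP[a [_ /mon_okP h] _].
  by have [_ /(_ wv)[]] := h (Ordinal wn1); rewrite finset.in_set1 eqxx.
move/(congr1 (dim I mu)): hq; rewrite raddf0 raddf_sum /= (bigD1_seq w) /=.
- rewrite big1_seq ?addr0 => [|v /andP[vw]].
    rewrite dimE // => e; rewrite -[RHS]e; apply: eq_bigr => lam _.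
    by rewrite (tw0 w.+1) // subr0.
  rewrite mem_index_iota => /andP[_ vn]; case: (ltngtP v w) vw => // vw _.
    rewrite (IH v vw vn) [const_lau _]raddf0 mul0r [KT_class _]raddf0; exact: raddf0.
  by rewrite dimE // big1 // => lam _; rewrite !tw0 ?subrr ?mul0rz // ltnW.
- by rewrite mem_index_iota.
- exact: (iota_uniq 0 n.+1).
Qed.

End KTheory.

(** * The expansion of xi^u xi^v *)

(* [iota] and [lm] stand for [const_lau] and [lmon]: computing in an abstract ring
   keeps unification from unfolding the product of the group ring. *)
Section Expansion.
Variables (n : nat) (A : comNzRingType) (iota : {rmorphism repring n -> A}).
Variable lm : weight n -> int -> A.
Hypothesis lmD : forall lam mu d e, lm (lam + mu) (d + e) = lm lam d * lm mu e.
Hypothesis lm0 : lm 0 0 = 1.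
Hypothesis iota_e : forall lam, iota (e_ lam) = lm lam 0.

Local Notation L := (linprod (eps n)).
Local Notation chi := (chi (eps n)).

Definition ev (p : {poly repring n}) : A := (map_poly iota p).[lm 0 1].

Lemma evM p q : ev (p * q) = ev p * ev q.
Proof. by rewrite /ev rmorphM hornerM. Qed.

Lemma evD p q : ev (p + q) = ev p + ev q.
Proof. by rewrite /ev rmorphD hornerD. Qed.

Lemma ev_sum I (r : seq I) (P : pred I) (F : I -> {poly repring n}) :
  ev (\sum_(i <- r | P i) F i) = \sum_(i <- r | P i) ev (F i).
Proof. by rewrite /ev rmorph_sum horner_sum. Qed.

Lemma lmX lam d j : lm lam d ^+ j = lm (lam *+ j) (d *+ j).
Proof. by elim: j => [|j IH]; rewrite ?lm0 // exprS IH !mulrS lmD. Qed.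

Lemma ev_monomial c j q : ev (c *: ('X^j * q)) = iota c * lm 0 j%:Z * ev q.
Proof.
rewrite -mul_polyC !evM mulrA; congr (_ * _ * _).
  by rewrite /ev map_polyC hornerC.
by rewrite /ev map_polyXn hornerXn lmX mul0rn natz.
Qed.

Lemma linprodS (mu : nat -> weight n) u :
  linprod mu u.+1 = (1 - e_ (mu u.+1) *: 'X) * linprod mu u.
Proof. exact: (@linear_prodS _ (fun i => e_ (mu i))). Qed.

Lemma ev_linprodS u : ev (L u.+1) = (1 - lm (eps n u.+1) 1) * ev (L u).
Proof.
rewrite linprodS evM; congr (_ * _).
rewrite /ev -mul_polyC rmorphB rmorph1 rmorphM /= map_polyC map_polyX.
by rewrite hornerD hornerN hornerC hornerM hornerC hornerX /= iota_e -lmD addr0 add0r.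
Qed.

Lemma chiS (mu : nat -> weight n) u : Defs.chi mu u.+1 = Defs.chi mu u + mu u.+1.
Proof. by rewrite /Defs.chi big_nat_recr. Qed.

Definition kosz u : A := \prod_(1 <= i < u.+1) (1 - lm (- eps n i) (-1)).

Lemma koszS u : kosz u.+1 = (1 - lm (- eps n u.+1) (-1)) * kosz u.
Proof. exact: big_prod1_recr. Qed.

Lemma lmNK lam d : lm lam d * lm (- lam) (- d) = 1.
Proof. by rewrite -lmD !subrr lm0. Qed.

(** With x = s e^(eps_i) and y = 1/x, each factor is 1 - y = -y (1 - x). *)
Lemma kosz_ev u : kosz u = (-1) ^+ u * lm (- chi u) (- u%:Z) * ev (L u).
Proof.
elim: u => [|u IH].
  rewrite /kosz /Defs.chi /linprod !big_nil oppr0 lm0 expr0 !mul1r.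
  by rewrite /ev rmorph1 hornerC.
rewrite koszS IH ev_linprodS chiS opprD (_ : - u.+1%:Z = - u%:Z + - 1); last by lia.
rewrite lmD exprS; have := lmNK (eps n u.+1) 1.
set x := lm (eps n u.+1) 1; set y := lm (- eps n u.+1) (-1) => xy.
have -> : 1 - y = - (y * (1 - x)) by rewrite mulrBr mulr1 [y * x]mulrC xy opprB.
by ring.
Qed.

Definition xiL u : A := kosz u - kosz u.+1.

Lemma xiL_ev u : xiL u = (-1) ^+ u * lm (- chi u.+1) (- u.+1%:Z) * ev (L u).
Proof.
rewrite /xiL koszS kosz_ev chiS opprD (_ : - u.+1%:Z = - u%:Z + - 1); last by lia.
by rewrite lmD; ring.
Qed.

Lemma size_lin1 (c : repring n) : (size (1 - c *: 'X : {poly repring n})%R <= 2)%N.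
Proof.
apply: leq_trans (size_polyD _ _) _; rewrite size_polyN geq_max size_poly1 /=.
by apply: leq_trans (size_scale_leq _ _) _; rewrite size_polyX.
Qed.

Lemma size_linprod (mu : nat -> weight n) u : (size (linprod mu u) <= u.+1)%N.
Proof.
elim: u => [|u IH]; first by rewrite /linprod big_nil size_poly1.
rewrite linprodS; apply: leq_trans (size_polyMleq _ _) _.
by have := size_lin1 (e_ (mu u.+1)); move: IH; lia.
Qed.

Lemma ev_expansion u v : exists y,
  ev (L u * L v) = \sum_(0 <= w < n.+1)
     iota (quot_coef (L u * L v) (L w.+1) (u%:Z + v%:Z - w%:Z + 1)) *
       lm 0 (u%:Z + v%:Z - w%:Z + 1) * ev (L w) + ev (L n.+1) * y.
Proof.
(* [F] has degree at most u + v; going one degree higher makes the exponents m - w equal to u + v -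
   w + 1. *)
pose m := (u + v).+1; set F := L u * L v.
have sF : (size F <= m.+1)%N.
  apply: leq_trans (size_polyMleq _ _) _.
  by have := size_linprod (eps n) u; have := size_linprod (eps n) v; rewrite /m; lia.
(* [N] is the smaller of n + 1 and m + 1. If m < n, then m + 1 divisions leave the quotient 0, and
   the terms with w > m have a negative index, hence coefficient 0. *)
have [N [Nm Nn ext]] : exists N,
    [/\ (N <= m.+1)%N, (N <= n.+1)%N & (N < n.+1)%N -> N = m.+1].
  by exists (minn n.+1 m.+1); rewrite geq_minl geq_minr; split=> //; lia.
have [H [sH eF]] := linear_prod_expansion (fun i => e_ (eps n i)) sF Nm.
exists (ev H); rewrite [F in LHS]eF evD addrC evM ev_sum.
pose T (w : nat) := iota (quot_coef F (L w.+1) (u%:Z + v%:Z - w%:Z + 1)) *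
  lm 0 (u%:Z + v%:Z - w%:Z + 1) * ev (L w).
have -> : \sum_(0 <= w < n.+1) T w = \sum_(0 <= w < N) T w.
  rewrite (big_cat_nat (leq0n N) Nn) -[RHS]addr0; congr (_ + _).
  rewrite big_nat_cond big1 //.
  move=> w /andP[/andP[Nw wn] _]; have e := ext (leq_ltn_trans Nw wn).
  rewrite /T; have : u%:Z + v%:Z - w%:Z + 1 < 0 by move: Nw; rewrite e /m; lia.
  by case: (_ + 1) => // q _; rewrite /quot_coef rmorph0 !mul0r.
have -> : ev (L n.+1) * ev H = ev (L N) * ev H.
  have [Nlt|] := ltnP N n.+1; last by move=> h; have -> : N = n.+1 by lia.
  suff -> : H = 0 by rewrite /ev rmorph0 horner0 !mulr0.
  by apply/eqP; rewrite -size_poly_eq0; move: sH; rewrite (ext Nlt); lia.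
congr (_ + _); apply: eq_big_nat => w /andP[_ wN]; rewrite /T.
have -> : u%:Z + v%:Z - w%:Z + 1 = (m - w)%N by rewrite /m; lia.
exact: ev_monomial.
Qed.

Lemma subr_cancel3 (V : zmodType) (a b c : V) : c - a - b - c = - a - b.
Proof. by rewrite [c - a]addrC -!addrA [c + _]addrCA subrr addr0. Qed.

Lemma xiL_product u v : exists y,
  xiL u * xiL v = \sum_(0 <= w < n.+1)
     iota ((-1) ^+ (u + v + w) * (e_ (chi w.+1 - chi u.+1 - chi v.+1) *
       quot_coef (L u * L v) (L w.+1) (u%:Z + v%:Z - w%:Z + 1))) * xiL w
     + y * kosz n.+1.
Proof.
have [y ey] := ev_expansion u v.
(* The sign and the monomial are the quotient of the prefactors of [xiL u * xiL v] and of
   [kosz n.+1]. *)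
exists ((-1) ^+ (u + v + n.+1) *
  lm (chi n.+1 - chi u.+1 - chi v.+1) (n.+1%:Z - u.+1%:Z - v.+1%:Z) * y).
rewrite !xiL_ev kosz_ev.
set a := lm (- chi u.+1) _; set b := lm (- chi v.+1) _.
have -> : (-1) ^+ u * a * ev (L u) * ((-1) ^+ v * b * ev (L v)) =
    (-1) ^+ (u + v) * (a * b) * ev (L u * L v) by rewrite evM exprD; ring.
rewrite ey mulrDr mulr_sumr {}/a {}/b -lmD; congr (_ + _); last first.
  have -> : lm (- chi u.+1 - chi v.+1) (- u.+1%:Z - v.+1%:Z) =
     lm (chi n.+1 - chi u.+1 - chi v.+1) (n.+1%:Z - u.+1%:Z - v.+1%:Z) *
     lm (- chi n.+1) (- n.+1%:Z).
    by rewrite -lmD; congr lm; [rewrite subr_cancel3|lia].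
  by rewrite (exprD _ (u + v)) -[LHS](signrMK n.+1); ring.
apply: eq_bigr => w _; rewrite xiL_ev.
set c := quot_coef _ _ _; rewrite !rmorphM rmorph_sign iota_e.
rewrite (exprD _ (u + v)).
(* The powers of s match, as -(u+1) - (v+1) + (u+v-w+1) = -(w+1); only a character is left over as
   coefficient. *)
have e : lm (- chi u.+1 - chi v.+1) (- u.+1%:Z - v.+1%:Z) *
    lm 0 (u%:Z + v%:Z - w%:Z + 1) =
  lm (chi w.+1 - chi u.+1 - chi v.+1) 0 * lm (- chi w.+1) (- w.+1%:Z).
  by rewrite -!lmD; congr lm; [rewrite addr0 subr_cancel3|lia].
rewrite -[LHS](signrMK w).
transitivity ((-1) ^+ w * (-1) ^+ w * ((-1) ^+ (u + v) * iota c * ev (L w)) *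
  (lm (- chi u.+1 - chi v.+1) (- u.+1%:Z - v.+1%:Z) * lm 0 (u%:Z + v%:Z - w%:Z + 1))).
  by ring.
by rewrite e; ring.
Qed.

End Expansion.

(** * The recursion *)

Section Recursion.
Variable n : nat.
Implicit Types (mu : nat -> weight n).

Definition ptilde_formula mu (u v w : nat) : repring n :=
  e_ (Defs.chi mu w.+1 - Defs.chi mu u.+1 - Defs.chi mu v.+1) *
  quot_coef (linprod mu u * linprod mu v) (linprod mu w.+1)
    (u%:Z + v%:Z - w%:Z + 1).

Lemma coef0_linprod mu u : (linprod mu u)`_0 = 1.
Proof. exact: (coef0_linear_prod (fun i => e_ (mu i))). Qed.

Lemma linprod_factor mu u w : (w <= u)%N ->
  exists2 M : {poly repring n}, (size M <= (u - w).+1)%N &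
    linprod mu u = M * linprod mu w.
Proof.
elim: u => [|u IH].
  by rewrite leqn0 => /eqP->; exists 1; rewrite ?mul1r // size_poly1.
rewrite leq_eqVlt => /orP[/eqP->|wu]; first by exists 1; rewrite ?mul1r // size_poly1.
have [M sM eM] := IH wu; exists ((1 - e_ (mu u.+1) *: 'X) * M).
  apply: leq_trans (size_polyMleq _ _) _.
  by have := size_lin1 (e_ (mu u.+1)); move: sM wu; rewrite ltnS; lia.
by rewrite linprodS eM mulrA.
Qed.

Lemma ptilde_formulaC mu u v w : ptilde_formula mu u v w = ptilde_formula mu v u w.
Proof.
rewrite /ptilde_formula addrAC [linprod mu v * _]mulrC.
by rewrite [v%:Z + _]addrC.
Qed.

(** Since L_(w+1) divides L_u, the quotient is a polynomial of degree at most u + v - w - 1, below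
    the index u + v - w + 1. *)
Lemma ptilde_formula0 mu u v w : (w < u)%N -> ptilde_formula mu u v w = 0.
Proof.
move=> wu; have [M sM eM] := linprod_factor mu wu.
rewrite /ptilde_formula eM mulrAC.
have -> : u%:Z + v%:Z - w%:Z + 1 = (u - w + v).+1%N by lia.
rewrite quot_coef_mulQ ?coef0_linprod // nth_default ?mulr0 //.
apply: leq_trans (size_polyMleq _ _) _.
have bound a b : (a <= (u - w.+1).+1 -> b <= v.+1 -> (a + b).-1 <= (u - w + v).+1)%N.
  by lia.
exact: (bound _ _ sM (size_linprod mu v)).
Qed.

Lemma ptilde_atE mu (u v w : nat) : ptilde_at mu u v w = ptilde_formula mu u v w.
Proof.
rewrite /ptilde_at; case: ifPn => //; rewrite negb_and -!ltnNge => /orP[h|h].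
  by rewrite ptilde_formula0.
by rewrite ptilde_formulaC ptilde_formula0.
Qed.

Lemma chi_shift mu u : Defs.chi mu u.+1 = mu 1%N + Defs.chi (fun i => mu i.+1) u.
Proof. by rewrite /Defs.chi big_ltn // big_add1. Qed.

Lemma e_D (a b : weight n) : e_ (a + b) = e_ a * e_ b.
Proof. exact: gexpD. Qed.

Lemma weight_shift (V : zmodType) (m1 m2 a b z : V) :
  m1 + a - (m1 + z) - (m1 + b) = m2 - m1 + (a - (z + m2) - b).
Proof.
rewrite [in LHS]opprD addrACA subrr add0r opprD addrA addrAC [LHS]addrC.
rewrite [m2 - _]addrC -[RHS]addrA; congr (_ + _).
by rewrite [- (z + m2)]opprD [a + _]addrA [_ - m2 - b]addrAC [RHS]addrC subrK.
Qed.

Lemma recursion0 (A : comNzRingType) (x y e e1 e2 : A) :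
  x = y -> e = e1 * e2 -> e * x = e1 * (e2 * y).
Proof. by move=> -> ->; rewrite mulrA. Qed.

(** [g] and [g'] are coefficients of one shifted quotient in consecutive degrees, and [B] is the
    character in front of the left-hand side; the two terms containing b g cancel. *)
Lemma recursionS (A : comNzRingType) (a a' b g g' x y B e1 e2 e3 e4 : A) :
  x = g' - a * g -> y = g' - b * g -> a' * a = 1 ->
  e1 = b * a' -> e2 = B * a -> e3 * e4 = B ->
  B * x = (e1 - 1) * (e2 * g) + e3 * (e4 * y).
Proof.
move=> -> -> aa -> -> eB; rewrite [e3 * _]mulrA eB.
have -> : (b * a' - 1) * (B * a * g) = B * g * (b * (a' * a) - a) by ring.
by rewrite aa; ring.
Qed.

Lemma ptilde_formula_rec mu u v w : (0 < v)%N ->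
  let shifted := fun i => mu i.+1 in
  ptilde_formula mu u v w =
    (e_ (mu u.+1 - mu 1%N) - 1)
      * ptilde_at shifted (u%:Z - 1) (v%:Z - 1) (w%:Z - 1)
    + e_ (mu u.+2 - mu 1%N)
      * ptilde_at shifted u%:Z (v%:Z - 1) (w%:Z - 1).
Proof.
case: v => // v _ sh; have -> : v.+1%:Z - 1 = v by lia.
case: w => [|w].
  (* For w = 0 the left side vanishes because v > w, the right side because w - 1 is negative. *)
  rewrite ptilde_formulaC ptilde_formula0 //.
  have z (i : int) : ptilde_at sh i v (0%:Z - 1) = 0 by case: i.
  by rewrite !z !mulr0 addr0.
have -> : w.+1%:Z - 1 = w by lia.
rewrite ptilde_atE; case: u => [|u].
  have z : ptilde_at sh (0%:Z - 1) v w = 0 by [].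
  (* For u = 0 the first term has a negative index, and in the second the first linear factor
     cancels completely. *)
  rewrite z mulr0 add0r; apply: recursion0.
    have -> : 0%:Z + v.+1%:Z - w.+1%:Z + 1 = 0%:Z + v%:Z - w%:Z + 1 by lia.
    exact: (quot_coef_shift0 (fun i => e_ (mu i))).
  rewrite -e_D; congr e_.
  by rewrite !(chi_shift mu) (chiS sh 0); apply: weight_shift.
have -> : u.+1%:Z - 1 = u by lia.
rewrite ptilde_atE; pose j := u.+1%:Z + v%:Z - w%:Z + 1.
have ej : u.+1%:Z + v.+1%:Z - w.+1%:Z + 1 = j by rewrite /j; lia.
have ej' : u%:Z + v%:Z - w%:Z + 1 = j - 1 by rewrite /j; lia.
apply: (@recursionS _ (e_ (mu 1%N)) (e_ (- mu 1%N)) (e_ (mu u.+2)) _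
  (quot_coef (linprod sh u * linprod sh v) (linprod sh w.+1) j)).
- rewrite ej ej'; exact: (quot_coef_shiftS (fun i => e_ (mu i))).
- rewrite ej'; exact: (quot_coef_stepS (fun i => e_ (sh i))).
- by rewrite -e_D addNr.
- exact: e_D.
- rewrite -e_D; congr e_; rewrite !(chi_shift mu) -/sh.
  rewrite [- (_ + Defs.chi sh u.+1)]opprD addrACA subrr add0r.
  by rewrite [- (_ + Defs.chi sh v.+1)]opprD addrA addrAC subrK.
- rewrite -e_D; congr e_; rewrite !(chi_shift mu) (chiS sh u.+1).
  exact/esym/weight_shift.
Qed.

End Recursion.

(** * The structure constants in closed form *)

Lemma structure_constantsE (k : fieldType) (n : nat)
    (mul : KT k n -> KT k n -> KT k n) (p : nat -> nat -> nat -> repring n) u v w :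
  KT_product mul -> structure_constants mul p ->
  (u <= n)%N -> (v <= n)%N -> (w <= n)%N ->
  p u v w = (-1) ^+ (u + v + w) * ptilde_formula (eps n) u v w.
Proof.
move=> Hmul Hp un vn.
(* The abstract ring is specialized to Laurent polynomials, where [kosz] and [xiL] become
   [koszul_prod] and [xi_lau]. *)
have [y ey] : exists y, xi_lau n u * xi_lau n v = \sum_(0 <= w < n.+1)
    const_lau ((-1) ^+ (u + v + w) * ptilde_formula (eps n) u v w) * xi_lau n w
    + y * koszul_prod n n.+1.
  exact: (xiL_product (@lmonD n) (lmon0 n) (@const_lau_e n) u v).
have := Hp u v un vn.
rewrite !xi_KT_class // (KT_class_mul _ _ Hmul) ey raddfD /= KT_class_koszul0 addr0.
move=> e wn; apply/eqP; rewrite -subr_eq0; apply/eqP.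
pose q w := p u v w - (-1) ^+ (u + v + w) * ptilde_formula (eps n) u v w.
apply: (@xi_lau_independent k n q) wn; move/eqP: e; rewrite eq_sym -subr_eq0.
rewrite [KT_class _ _]raddf_sum /= -sumrB => /eqP e.
rewrite -[RHS]e; apply: eq_big_nat => j jn.
rewrite from_repring_KT_class xi_KT_class // (KT_class_mul _ _ Hmul).
by rewrite -raddfB /= /q raddfB mulrBl.
Qed.

(* The recursion over the complex numbers *)
From mathcomp Require Import complex reals.

Theorem theorem6p11 (R : realType) (n : nat)
    (mul : KT R[i] n -> KT R[i] n -> KT R[i] n) (Hmul : KT_product mul)
    (p : nat -> nat -> nat -> repring n) (Hp : structure_constants mul p)
    (u v w : nat) (Hu : (u <= n)%N) (Hv : (v <= n)%N) (Hw : (w <= n)%N)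
    (Hv1 : (1 <= v)%N) :
  let shifted := fun i : nat => eps n i.+1 in
  (-1) ^+ (u + v + w) * p u v w =
    (e_ (eps n u.+1 - eps n 1) - 1)
      * ptilde_at shifted (u%:Z - 1) (v%:Z - 1) (w%:Z - 1)
    + e_ (eps n u.+2 - eps n 1)
      * ptilde_at shifted u%:Z (v%:Z - 1) (w%:Z - 1).
Proof.
rewrite (structure_constantsE Hmul Hp) // signrMK.
exact: ptilde_formula_rec.
Qed.
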